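(* Let $p\in(1,2)$, let $c \ge 1$ be any constant, and let $\alpha \in (0, \frac1p - \frac12)$ be arbitrary. For all sufficiently large $k \in \mathbb{N}$, let $n = O(k(\log k)^c)$ and let $M \in \mathbb{R}^{(k+n)\times n}$ be a random matrix whose top $k \times n$ submatrix has i.i.d. $N(0,1)$ entries and whose bottom $n \times n$ submatrix is the identity matrix. Then, with probability $1 - 2^{-\Theta(k)}$, for every subset $S \subset [n]$ with $|S| \le \frac n2$, $$\min_{X \in \mathbb{R}^{|S| \times n}} \|M_S X - M\|_p \;\ge\; \Omega\!\left(k^{\frac1p - \frac12 - \alpha}\right) \min_{M_k \text{ of rank at most } k} \|M_k - M\|_p .$$ Here the hidden constants and the threshold for $k$ may depend on $p$, $c$, $\alpha$ and the constant in $n=O(k(\log k)^c)$.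
   Context: For a matrix $B$, $\|B\|_p = (\sum_{i,j}|B_{i,j}|^p)^{1/p}$ (entrywise norm). $M_S$ denotes the submatrix of $M$ consisting of the columns indexed by $S$. ''With probability $1-2^{-\Theta(k)}$'' means with probability at least $1-2^{-c'k}$ for some constant $c'>0$. *)

(* Defs.v *)
From HB Require Import structures.
From mathcomp Require Import all_boot all_order all_algebra.
From mathcomp Require Import all_classical all_reals all_analysis.

Set Implicit Arguments.
Unset Strict Implicit.
Unset Printing Implicit Defensive.

Import Order.TTheory GRing.Theory Num.Theory.
Local Open Scope classical_set_scope.
Local Open Scope ring_scope.

Definition entry_norm (R : realType) (p : R) (m n : nat) (B : 'M[R]_(m, n)) : R :=
  (\sum_i \sum_j `|B i j| `^ p) `^ p^-1.

Definition col_select (R : realType) (m n : nat) (M : 'M[R]_(m, n))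
    (S : {set 'I_n}) : 'M[R]_(m, #|S|) :=
  colsub (fun i : 'I_#|S| => enum_val i) M.

(* The two minima below are infima of nonempty sets of reals (they contain the
   error of the zero matrix) that are bounded below by 0; both are attained,
   the first because the column span of [M_S] is closed, the second because
   the set of matrices of rank at most [r] is closed. *)
Definition css_error (R : realType) (p : R) (m n : nat) (M : 'M[R]_(m, n))
    (S : {set 'I_n}) : R :=
  inf [set entry_norm p (col_select M S *m X - M) | X in [set: 'M[R]_(#|S|, n)]].

Definition rank_error (R : realType) (p : R) (r : nat) (m n : nat)
    (M : 'M[R]_(m, n)) : R :=
  inf [set entry_norm p (Mr - M) | Mr in [set Mr : 'M[R]_(m, n) | (\rank Mr <= r)%N]].

(* Mutual independence of a finite family: the product rule over every
   subfamily [J]. *)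
Definition mutually_independent (d : measure_display) (T : measurableType d)
    (R : realType) (P : probability T R) (I : finType) (Y : I -> {RV P >-> R}) : Prop :=
  forall (J : {set I}) (B : I -> set R),
    (forall i, measurable (B i)) ->
    P (\bigcap_(i in [set` J]) (Y i @^-1` B i)) =
      (\prod_(i in J) P (Y i @^-1` B i))%E.

Definition iid_standard_normal (d : measure_display) (T : measurableType d)
    (R : realType) (P : probability T R) (I : finType) (Y : I -> {RV P >-> R}) : Prop :=
  mutually_independent Y /\
  (forall (i : I) (B : set R), measurable B ->
    distribution P (Y i) B = normal_prob 0 1 B).

Definition gauss_over_id (d : measure_display) (T : measurableType d)
    (R : realType) (P : probability T R) (k n : nat)
    (G : 'I_k * 'I_n -> {RV P >-> R}) (w : T) : 'M[R]_(k + n, n) :=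
  col_mx (\matrix_(i, j) G (i, j) w) 1%:M.

(* Main.v *)
(** Taking [M_k = [G; 0]] shows that the rank-[k] error is at most [n^(1/p)]
    (and it vanishes when [n <= k]), so it suffices that every column outside
    [S] costs at least [t^p], where [t = k^(1/p - 1/2 - alpha)].

    Suppose a coefficient vector [x] is so cheap that [||x||_p < t] and
    [||G x - g_j||_p < t]. At most a small constant fraction [r] of [k] of its
    entries exceed [theta = t r^(-1/p)]. The remaining entries form a vector
    of Euclidean norm at most [t r^(1/2 - 1/p)], roughly [k^(-alpha)], so
    [||G|| <= sqrt n k^o(1)] makes their image negligible against [sqrt k].
    Hence [g_j] would lie much closer than [sqrt k] to the span of [r] other
    columns. With the exponent [k^(-alpha)] to spare, both the operator norm
    bound and the distance bound follow from union bounds over crude grids of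
    polynomial mesh. The entries of [G] are likewise rounded to grid cells, so
    that only the product rule for boxes is needed. *)

Require Import Defs.
From HB Require Import structures.
From mathcomp Require Import all_boot all_order all_algebra.
From mathcomp Require Import all_classical all_reals all_analysis.
From mathcomp Require Import measurable_realfun.
From mathcomp Require Import ring lra zify.

Set Implicit Arguments.
Unset Strict Implicit.
Unset Printing Implicit Defensive.

Import Order.TTheory GRing.Theory Num.Theory.
Import numFieldNormedType.Exports.
Local Open Scope classical_set_scope.
Local Open Scope ring_scope.

(** * Measurability of the two errors *)

Lemma continuous_sum_fun (R : realType) (I : finType) (U : topologicalType)
    (F : I -> U -> R) :
  (forall i, continuous (F i)) -> continuous (fun u => \sum_i F i u).
Proof. by move=> cF; apply: continuous_big => //; exact: add_continuous. Qed.

(** Differentiability of the power function gives continuity away from 0 only; at 0 the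
    neighbourhood [|y| < e^(1/p)] is used instead. *)
Lemma norm_powR_continuous (R : realType) (p : R) :
  0 < p -> continuous (fun x : R => `|x| `^ p).
Proof.
move=> p0 x; have [->|x0] := eqVneq x 0.
  apply/cvgrPdist_lt => e e0; near=> y.
  rewrite normr0 powR0 ?gt_eqF// sub0r normrN ger0_norm ?powR_ge0//.
  have -> : e = (e `^ p^-1) `^ p.
    by rewrite -powRrM mulVf ?gt_eqF// powRr1 ?ltW.
  apply: gt0_ltr_powR => //; rewrite ?nnegrE ?powR_ge0//.
  near: y; apply: (@cvgr0_norm_lt _ _ _ _ _ id); first exact: cvg_id.
  by rewrite powR_gt0.
have px : 0 < `|x| by rewrite normr_gt0.
rewrite (_ : (fun y => _) = (fun z : R => z `^ p) \o (fun y : R => `|y|)) //.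
apply: continuous_comp; first exact: norm_continuous.
apply: differentiable_continuous; apply/derivable1_diffP.
by apply: derivable_powR; rewrite in_itv/= px.
Unshelve. all: by end_near. Qed.

Lemma entry_norm_continuous (R : realType) (p : R) (m n : nat)
    (U : topologicalType) (F : U -> 'M[R]_(m, n)) :
  0 < p -> (forall i j, continuous (fun u => F u i j)) ->
  continuous (fun u => entry_norm p (F u)).
Proof.
move=> p0 cF; rewrite /entry_norm.
set f := fun u => \sum_i \sum_j `|F u i j| `^ p.
have f0 u' : 0 <= f u'.
  by apply: sumr_ge0 => i _; apply: sumr_ge0 => j _; rewrite powR_ge0.
rewrite (_ : (fun u => _) = (fun x : R => `|x| `^ p^-1) \o f); last first.
  by apply/funext => u' /=; rewrite ger0_norm.
move=> u; apply: continuous_comp; last first.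
  by apply: norm_powR_continuous; rewrite invr_gt0.
apply: continuous_sum_fun => i; apply: continuous_sum_fun => j {}u.
rewrite (_ : (fun u => _) =
  (fun x : R => `|x| `^ p) \o (fun u => F u i j)) //.
apply: continuous_comp; first exact: cF.
exact: norm_powR_continuous.
Qed.

Lemma measurable_entry_norm (R : realType) (p : R) (m n : nat) d
    (T : measurableType d) (F : T -> 'M[R]_(m, n)) :
  (forall i j, measurable_fun setT (fun w => F w i j)) ->
  measurable_fun setT (fun w => entry_norm p (F w)).
Proof.
move=> mF; rewrite /entry_norm.
apply: (@measurableT_comp _ _ _ _ _ _ (fun x => x `^ p^-1)) => //.
apply: measurable_sum => i; apply: measurable_sum => j.
apply: (@measurableT_comp _ _ _ _ _ _ (fun x => x `^ p)) => //.
apply: (@measurableT_comp _ _ _ _ _ _ (fun x : R => `|x|)); last exact: mF.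
exact: normr_measurable.
Qed.

Lemma dense_ratr_matrix (R : realType) (a b : nat) (A : set 'M[R]_(a, b))
    (X : 'M[R]_(a, b)) :
  nbhs X A -> exists Q : 'M[rat]_(a, b), A (map_mx ratr Q).
Proof.
move=> /nbhs_ballP[e /= e0 eA].
have /choice[q hq] : forall ij : 'I_a * 'I_b, exists q : rat,
    ball (X ij.1 ij.2) e (ratr q : R).
  move=> [i j] /=; have [|q] := @rat_in_itvoo R (X i j) (X i j + e).
    by rewrite ltrDl.
  rewrite in_itv/= => /andP[q1 q2]; exists q.
  by rewrite /ball/= ltr0_norm ?subr_lt0// opprB ltrBlDl.
exists (\matrix_(i, j) q (i, j)); apply: eA; split => // i j.
by rewrite !mxE; exact: (hq (i, j)).
Qed.

(* By density the infimum over real matrices is a countable infimum. *)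
Lemma measurable_inf_matrix (R : realType) (a b : nat) d (T : measurableType d)
    (F : T -> 'M[R]_(a, b) -> R) :
  (forall w X, 0 <= F w X) -> (forall w, continuous (F w)) ->
  (forall X, measurable_fun setT (F ^~ X)) ->
  measurable_fun setT (fun w => inf [set F w X | X in setT]).
Proof.
move=> F0 cF mF mD.
apply: (measurability _ (RGenInftyO.measurableE R)) => //.
move=> _ [_ [x ->] <-]; rewrite setTI.
(* Rational matrices are indexed by their pickle codes; a number that codes no matrix contributes
   the empty set. *)
pose G n := if unpickle n is Some Q then
  [set w | F w (map_mx ratr (Q : 'M[rat]_(a, b))) < x] else set0.
rewrite (_ : _ @^-1` _ = \bigcup_n G n).
  apply: bigcupT_measurable => n; rewrite /G.
  case: unpickle => [Q|//].
  have /(_ measurableT [set true]) := measurable_fun_ltr (mF (map_mx ratr Q))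
    (@measurable_cst _ _ _ _ setT x).
  by rewrite setTI; apply.
apply/seteqP; split => w /=; rewrite in_itv/=.
  case/inf_lt; first by exists (F w 0); exists 0.
  move=> _ [X _ <-] FX.
  have : nbhs X [set Y | F w Y < x].
    by have := cF w X; move=> /cvgr_lt /(_ _ FX).
  move=> /dense_ratr_matrix[Q /= hQ].
  by exists (pickle Q) => //; rewrite /G pickleK.
move=> [n _]; rewrite /G; case: unpickle => [Q|//] /= hQ.
apply: le_lt_trans hQ; apply: ge_inf; last by eexists.
by exists 0 => _ [X _ <-].
Qed.

Lemma continuous_mulmx_entry (R : realType) (U : topologicalType) (a b c : nat)
    (A : U -> 'M[R]_(a, b)) (B : U -> 'M[R]_(b, c)) i j :
  (forall i j, continuous (fun u => A u i j)) ->
  (forall i j, continuous (fun u => B u i j)) ->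
  continuous (fun u => (A u *m B u) i j).
Proof.
move=> cA cB.
rewrite (_ : (fun u => _) = (fun u => \sum_l A u i l * B u l j)); last first.
  by apply/funext => v; rewrite mxE.
apply: continuous_sum_fun => l u.
by apply: continuousM; [exact: cA | exact: cB].
Qed.

Lemma measurable_css_error (R : realType) (p : R) (m n : nat) d
    (T : measurableType d) (M : T -> 'M[R]_(m, n)) (S : {set 'I_n}) :
  0 < p -> (forall i j, measurable_fun setT (fun w => M w i j)) ->
  measurable_fun setT (fun w => css_error p (M w) S).
Proof.
move=> p0 mM; apply: measurable_inf_matrix => [w X|w|X].
- exact: powR_ge0.
- apply: entry_norm_continuous => // i j.
  rewrite (_ : (fun u => _) =
      (fun u => (col_select (M w) S *m u) i j - M w i j)); last first.
    by apply/funext => u; rewrite !mxE.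
  move=> u; apply: continuousB; last exact: cst_continuous.
  apply: continuous_mulmx_entry => // [i' j' u'|i' j'].
    exact: cst_continuous.
  exact: coord_continuous.
- apply: measurable_entry_norm => i j.
  rewrite (_ : (fun w => _) =
      (fun w => \sum_l M w i (enum_val l) * X l j - M w i j)); last first.
    by apply/funext => w; rewrite !mxE; under eq_bigr do rewrite mxE.
  apply: measurable_funB => //; apply: measurable_sum => l.
  exact: measurable_funM.
Qed.

(** This parametrises the rank constraint by unconstrained factors, turning the rank error into an
    infimum over a full matrix space, the form required by [measurable_inf_matrix]. *)
Lemma mxrank_leP (F : fieldType) (m n r : nat) (A : 'M[F]_(m, n)) :
  (\rank A <= r)%N <->
  exists (U : 'M[F]_(m, r)) (V : 'M[F]_(r, n)), A = U *m V.
Proof.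
split => [rA|[U [V ->]]]; last first.
  by rewrite (leq_trans (mxrankM_maxl _ _))// rank_leq_col.
exists (col_ebase A *m pid_mx (\rank A)), (pid_mx (\rank A) *m row_ebase A).
by rewrite mulmxA -(mulmxA (col_ebase A)) pid_mx_id// mulmx_ebase.
Qed.

Lemma measurable_rank_error (R : realType) (p : R) (r m n : nat) d
    (T : measurableType d) (M : T -> 'M[R]_(m, n)) :
  0 < p -> (forall i j, measurable_fun setT (fun w => M w i j)) ->
  measurable_fun setT (fun w => rank_error p r (M w)).
Proof.
move=> p0 mM.
(* Both factors are packed side by side into one matrix, the left one transposed so that the row
   counts agree. *)
pose Phi (X : 'M[R]_(r, m + n)) := (lsubmx X)^T *m rsubmx X.
rewrite (_ : (fun w => _) =
    (fun w => inf [set entry_norm p (Phi X - M w) | X in setT])); last first.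
  apply/funext => w; rewrite /rank_error; congr inf.
  apply/seteqP; split => _ [Mr /= hM <-].
    have /mxrank_leP[U [V ->]] := hM.
    exists (row_mx U^T V); first by [].
    by congr (entry_norm p (_ - _)); rewrite /Phi row_mxKl row_mxKr trmxK.
  exists (Phi Mr); last by [].
  by apply/mxrank_leP; exists (lsubmx Mr)^T, (rsubmx Mr).
apply: measurable_inf_matrix => [w X|w|X].
- exact: powR_ge0.
- apply: entry_norm_continuous => // i j.
  rewrite (_ : (fun u => _) = (fun u => Phi u i j - M w i j)); last first.
    by apply/funext => u; rewrite !mxE.
  move=> u; apply: continuousB; last exact: cst_continuous.
  apply: continuous_mulmx_entry => i' j'.
    rewrite [X in continuous X](_ : _ =
        (fun u : 'M[R]_(r, m + n) => u j' (lshift n i'))).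
      exact: coord_continuous.
    by apply/funext => v; rewrite !mxE.
  rewrite [X in continuous X](_ : _ =
      (fun u : 'M[R]_(r, m + n) => u i' (rshift m j'))).
    exact: coord_continuous.
  by apply/funext => v; rewrite !mxE.
- apply: measurable_entry_norm => i j.
  rewrite (_ : (fun w => _) = (fun w => Phi X i j - M w i j)); last first.
    by apply/funext => w; rewrite !mxE.
  exact: measurable_funB.
Qed.

Lemma measurable_gauss_over_id (R : realType) d (T : measurableType d)
    (P : probability T R) (k n : nat) (G : 'I_k * 'I_n -> {RV P >-> R}) i j :
  measurable_fun setT (fun w => gauss_over_id G w i j).
Proof.
case: (split_ordP i) => i' ->.
  rewrite (_ : (fun w => _) = G (i', j)); first exact: measurable_funPT.
  by apply/funext => w; rewrite /gauss_over_id col_mxEu mxE.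
rewrite (_ : (fun w => _) = cst ((1%:M : 'M[R]_n) i' j)) //.
by apply/funext => w; rewrite /gauss_over_id col_mxEd.
Qed.

(** * Deterministic bounds on the two errors *)

Lemma entry_norm_ge0 (R : realType) (p : R) (m n : nat) (B : 'M[R]_(m, n)) :
  0 <= entry_norm p B.
Proof. exact: powR_ge0. Qed.

Lemma rank_error_le (R : realType) (p : R) (r m n : nat) (M Mr : 'M[R]_(m, n)) :
  (\rank Mr <= r)%N -> rank_error p r M <= entry_norm p (Mr - M).
Proof.
move=> rMr; apply: ge_inf; last by exists Mr.
by exists 0 => _ [X _ <-]; exact: entry_norm_ge0.
Qed.

Lemma css_error_ge0 (R : realType) (p : R) (m n : nat) (M : 'M[R]_(m, n))
    (S : {set 'I_n}) : 0 <= css_error p M S.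
Proof.
apply: lb_le_inf; first by exists (entry_norm p (col_select M S *m 0 - M)), 0.
by move=> _ [X _ <-]; exact: entry_norm_ge0.
Qed.

Lemma rank_error_le0 (R : realType) (p : R) (r m n : nat) (M : 'M[R]_(m, n)) :
  0 < p -> (n <= r)%N -> rank_error p r M <= 0.
Proof.
move=> p0 nr; apply: le_trans (rank_error_le _ _ (leq_trans (rank_leq_col M) nr)) _.
rewrite subrr /entry_norm big1 ?powR0 ?gt_eqF ?invr_gt0// => i _.
by rewrite big1// => j _; rewrite mxE normr0 powR0 ?gt_eqF.
Qed.

Lemma rank_error_col_mx1 (R : realType) (p : R) (k n : nat) (A : 'M[R]_(k, n)) :
  0 < p -> rank_error p k (col_mx A 1%:M) <= n%:R `^ p^-1.
Proof.
move=> p0; have rA : (\rank (col_mx A (0 : 'M[R]_n)) <= k)%N.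
  by rewrite -addsmxE addsmx0 rank_leq_row.
apply: le_trans (rank_error_le _ _ rA) _.
rewrite /entry_norm big_split_ord/= big1 ?add0r => [|i _]; last first.
  rewrite big1// => j _.
  by rewrite mxE !col_mxEu mxE col_mxEu subrr normr0 powR0 ?gt_eqF.
rewrite (eq_bigr (fun=> 1)) ?sumr_const ?card_ord// => i _.
rewrite (bigD1 i)//= big1 ?addr0 => [|j ji].
  by rewrite mxE col_mxEd [X in _ + X]mxE col_mxEd !mxE eqxx sub0r normrN normr1 powR1.
rewrite mxE col_mxEd [X in _ + X]mxE col_mxEd !mxE eq_sym (negbTE ji) subrr normr0.
by rewrite powR0 ?gt_eqF.
Qed.

(** At least [n/2] columns lie outside [S]. For such a column the coefficient vector, extended by
    zeros, vanishes at [j], and the identity block charges it its own p-th power sum. Hence each of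
    these columns costs at least [T]. *)
Lemma css_error_col_mx1_ge (R : realType) (p T : R) (k n : nat)
    (A : 'M[R]_(k, n)) (S : {set 'I_n}) :
  0 < p -> 0 <= T ->
  (forall (j : 'I_n) (y : 'I_n -> R), y j = 0 ->
    T <= \sum_i `|\sum_l A i l * y l - A i j| `^ p + \sum_l `|y l| `^ p) ->
  #|S|%:R <= n%:R / 2 :> R ->
  (n%:R / 2 * T) `^ p^-1 <= css_error p (col_mx A 1%:M) S.
Proof.
move=> p0 T0 hT hS; apply: lb_le_inf.
  by exists (entry_norm p (col_select (col_mx A 1%:M) S *m 0 - col_mx A 1%:M)), 0.
move=> _ [X _ <-].
(* [Y] extends [X] by zero rows outside [S]. *)
pose Y := col_select 1%:M S *m X.
have YE i j : (col_select (col_mx A 1%:M) S *m X) i j = (col_mx A 1%:M *m Y) i j.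
  rewrite mulmxA; congr (fun_of_matrix (_ *m X) i j).
  apply/matrixP => a b; rewrite !mxE (bigD1 (enum_val b))//=.
  rewrite !mxE eqxx mulr1 big1 ?addr0// => c cb.
  by rewrite !mxE (negbTE cb) mulr0.
have Y0 l j : l \notin S -> Y l j = 0.
  move=> lS; rewrite mxE big1// => a _; rewrite !mxE.
  case: eqP => [la|_]; last by rewrite mul0r.
  by move: lS; rewrite la enum_valP.
apply: ge0_ler_powR; rewrite ?invr_ge0 ?(ltW p0)// ?nnegrE.
- by rewrite mulr_ge0.
- by apply: sumr_ge0 => i _; apply: sumr_ge0 => j _; rewrite powR_ge0.
rewrite exchange_big/=.
apply: (@le_trans _ _ (\sum_(j in ~: S) T)).
  rewrite sumr_const -[leRHS]mulr_natl; apply: ler_wpM2r => //.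
  have : (#|S| + #|~: S|)%:R = n%:R :> R by rewrite cardsC card_ord.
  by rewrite natrD; move: hS; lra.
rewrite [leRHS](bigID (fun j => j \in ~: S))/=.
rewrite -[leLHS]addr0; apply: lerD; last first.
  by apply: sumr_ge0 => i _; apply: sumr_ge0 => j _; rewrite powR_ge0.
apply: ler_sum => j; rewrite inE => jS.
apply: (le_trans (hT j (fun l => Y l j) (Y0 _ _ jS))).
rewrite big_split_ord/=; apply: lerD.
  apply: ler_sum => i _; rewrite mxE YE mul_col_mx col_mxEu mxE.
  by rewrite [(- col_mx A 1%:M) _ _]mxE col_mxEu.
apply: ler_sum => l _; rewrite [(_ - col_mx A 1%:M) _ _]mxE YE.
rewrite mul_col_mx mul1mx col_mxEd.
rewrite [(- col_mx A 1%:M) _ _]mxE col_mxEd [X in Y l j - X]mxE.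
(* At [l = j] the identity contributes an extra error of 1, which is simply dropped. *)
case: eqP => [lj|_]; last by rewrite subr0.
by rewrite lj Y0// normr0 powR0 ?gt_eqF// powR_ge0.
Qed.

(** * Gaussian measure of intervals *)

(** The mass of [A] under N(l,1) as a real number; nonzero means [l] arise from exponential
    tilting. *)
Definition nprob (R : realType) (l : R) (A : set R) : R :=
  fine (normal_prob l 1 A).

Lemma nprob_fin (R : realType) (l : R) (A : set R) : measurable A ->
  (nprob l A)%:E = normal_prob l 1 A.
Proof.
move=> mA; rewrite /nprob fineK//.
exact: (@fin_num_measure _ _ _ (normal_prob l 1 : probability _ _)).
Qed.

Lemma nprob_ge0 (R : realType) (l : R) (A : set R) : 0 <= nprob l A.
Proof. by apply: fine_ge0; exact: (measure_ge0 (normal_prob l 1)). Qed.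

Lemma nprobT (R : realType) (l : R) : nprob l setT = 1.
Proof.
by rewrite /nprob (@probability_setT _ _ _ (normal_prob l 1 : probability _ _)).
Qed.

Lemma nprob_le (R : realType) (l : R) (A B : set R) :
  measurable A -> measurable B -> A `<=` B -> nprob l A <= nprob l B.
Proof.
move=> mA mB AB; rewrite -lee_fin !nprob_fin//.
by apply: (@le_measure _ _ _ (normal_prob l 1)); rewrite ?inE.
Qed.

Lemma nprob_le1 (R : realType) (l : R) (A : set R) :
  measurable A -> nprob l A <= 1.
Proof. by move=> mA; rewrite -(nprobT l); exact: nprob_le. Qed.

Lemma sum_nprob_le1 (R : realType) (l : R) (N : nat) (F : nat -> set R) :
  (forall v, measurable (F v)) -> trivIset setT F ->
  \sum_(v < N) nprob l (F v) <= 1.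
Proof.
move=> mF tF; rewrite -lee_fin -sumEFin.
under eq_bigr do rewrite nprob_fin//.
rewrite -(@measure_bigsetU _ _ _ (normal_prob l 1))//.
apply: (@probability_le1 _ _ _ (normal_prob l 1 : probability _ _)).
by apply: bigsetU_measurable => i _; exact: mF.
Qed.

Lemma normal_pdf_shift (R : realType) (l x : R) :
  normal_pdf 0 1 x * expR (l * x) = expR (l ^+ 2 / 2) * normal_pdf l 1 x.
Proof.
rewrite !normal_pdfE ?oner_eq0// mulrCA -mulrA; congr (_ * _).
rewrite /normal_fun -!expRD; congr expR.
by rewrite !expr1n subr0; field.
Qed.

(* Change of measure: an exponential tilt turns N(0,1) into N(l,1). *)
Lemma nprob_shift (R : realType) (l b : R) (A : set R) : measurable A ->
  (forall x, A x -> b <= l * x) ->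
  expR b * nprob 0 A <= expR (l ^+ 2 / 2) * nprob l A.
Proof.
move=> mA Ab; rewrite -lee_fin !EFinM !nprob_fin// /normal_prob.
have mpdf m : measurable_fun A (fun x => (normal_pdf m 1 x)%:E : \bar R).
  apply/measurable_EFinP; apply: measurable_funTS.
  exact: measurable_normal_pdf.
have pdf0 m (x : R) : A x -> (0 <= (normal_pdf m 1 x)%:E)%E.
  by move=> _; rewrite lee_fin normal_pdf_ge0.
rewrite -!ge0_integralZl_EFin ?expR_ge0//; try exact: pdf0; try exact: mpdf.
apply: ge0_le_integral => //.
- by move=> x Ax; rewrite mule_ge0// ?lee_fin ?expR_ge0 ?normal_pdf_ge0.
- by apply: measurable_funeM; exact: mpdf.
- by apply: measurable_funeM; exact: mpdf.
- move=> x Ax; rewrite -!EFinM lee_fin -normal_pdf_shift mulrC.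
  by rewrite ler_wpM2l ?normal_pdf_ge0// ler_expR Ab.
Qed.

(** Tilt by [K] on the right tail and by [-K] on the left one: there [l * x] is at least [K^2],
    while the tilt costs only [K^2 / 2]. *)
Lemma nprob_tail (R : realType) (K : R) : 0 <= K ->
  nprob 0 `[K, +oo[ <= expR (- (K ^+ 2 / 2)) /\
  nprob 0 `]-oo, - K] <= expR (- (K ^+ 2 / 2)).
Proof.
move=> K0.
suff H (l : R) A : measurable A -> l ^+ 2 = K ^+ 2 ->
    (forall x, A x -> K ^+ 2 <= l * x) -> nprob 0 A <= expR (- (K ^+ 2 / 2)).
  split; [apply: (H K) => //|apply: (H (- K)) => //].
  - by move=> x /=; rewrite in_itv/= andbT expr2 => Kx; rewrite ler_wpM2l.
  - by rewrite sqrrN.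
  - move=> x /=; rewrite in_itv/= expr2 => xK.
    by rewrite mulNr -mulrN ler_wpM2l// lerNr.
move=> mA lK /(nprob_shift mA); rewrite lK => h.
rewrite -(ler_pM2l (expR_gt0 (K ^+ 2))) -expRD.
rewrite (_ : K ^+ 2 - _ = K ^+ 2 / 2); last by field.
by apply: (le_trans h); rewrite ler_piMr ?expR_ge0 ?nprob_le1.
Qed.

(** The density is at most [1 / sqrt (2 pi)], hence at most 1. *)
Lemma nprob_itv_le (R : realType) (a b : R) : a <= b ->
  nprob 0 `[a, b] <= b - a.
Proof.
move=> ab; rewrite -lee_fin nprob_fin// /normal_prob.
apply: (@le_trans _ _ (\int[lebesgue_measure]_(x in `[a, b]) (cst 1%E) x)%E).
  apply: ge0_le_integral => //.
  - by move=> x _; rewrite lee_fin normal_pdf_ge0.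
  - apply/measurable_EFinP; apply: measurable_funTS.
    exact: measurable_normal_pdf.
  - move=> x _; rewrite lee_fin; apply: le_trans (normal_pdf_ub _ _ _) _ => //.
    rewrite /normal_peak invf_le1 ?sqrtr_gt0.
      rewrite expr1n mul1r -[leLHS]sqrtr1 ler_wsqrtr// mulr2n.
      by have := pi_ge2 R; lra.
    by rewrite expr1n mul1r mulrn_wgt0// pi_gt0.
have e : lebesgue_measure (`[a, b]%classic : set R) = (b - a)%:E.
  rewrite lebesgue_measure_itv/= lte_fin; case: ltP => // ba.
  by rewrite (le_anti (introT andP (conj ab ba))) subrr.
by rewrite integral_cst// mul1e le_eqVlt; apply/orP; left; apply/eqP.
Qed.

(** * Grid cells and union bounds *)

(** The grid has mesh [1/m] and starts at [-k], so the indices up to [2 * k * m] serve all of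
    [[-k, k]]. *)
Definition gridval (R : realType) (k m v : nat) : R := v%:R / m%:R - k%:R.

Definition cell (R : realType) (k m v : nat) : set R :=
  `[gridval R k m v, gridval R k m v + m%:R^-1[.
Arguments cell : clear implicits.

Lemma measurable_cell (R : realType) (k m v : nat) : measurable (cell R k m v).
Proof. exact: measurable_itv. Qed.

Lemma cellE (R : realType) (k m v : nat) (x : R) : (0 < m)%N ->
  cell R k m v x <-> v%:R <= (x + k%:R) * m%:R < v.+1%:R.
Proof.
move=> m0; have mR : 0 < m%:R :> R by rewrite ltr0n.
have e : gridval R k m v + m%:R^-1 = v.+1%:R / m%:R - k%:R.
  by rewrite /gridval -natr1 mulrDl mul1r addrAC.
by rewrite /cell/= in_itv/= e lerBlDr ler_pdivrMr// ltrBrDr ltr_pdivlMr.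
Qed.

Lemma trivIset_cell (R : realType) (k m : nat) : (0 < m)%N ->
  trivIset setT (cell R k m).
Proof.
move=> m0; apply/trivIsetP => i j _ _ ij; apply/seteqP; split => // x [].
move=> /(cellE _ _ _ m0) /andP[i1 i2] /(cellE _ _ _ m0) /andP[j1 j2].
have := le_lt_trans i1 j2; have := le_lt_trans j1 i2.
by rewrite !ltr_nat; move: ij; lia.
Qed.

Lemma cell_cover (R : realType) (k m : nat) (x : R) : (0 < m)%N -> `|x| <= k%:R ->
  exists v : 'I_(2 * k * m).+1, cell R k m v x.
Proof.
move=> m0; rewrite ler_norml => /andP[x1 x2].
have y0 : 0 <= (x + k%:R) * m%:R by rewrite mulr_ge0//; move: x1; lra.
have := truncn_itv y0; set v := Num.truncn _ => hv.
have vN : (v < (2 * k * m).+1)%N.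
  rewrite ltnS -(ler_nat R); move: hv => /andP[/le_trans + _]; apply.
  by rewrite !natrM ler_wpM2r//; move: x2; lra.
by exists (Ordinal vN); apply/cellE.
Qed.

Lemma cell_dist (R : realType) (k m v : nat) (x y : R) :
  cell R k m v x -> cell R k m v y -> `|x - y| <= m%:R^-1.
Proof. by rewrite /cell/= !in_itv/= ler_norml => *; apply/andP; split; lra. Qed.

Lemma cell_gridval (R : realType) (k m v : nat) : (0 < m)%N ->
  cell R k m v (gridval R k m v).
Proof.
by move=> m0; rewrite /cell/= in_itv/= lexx ltrDl invr_gt0 ltr0n.
Qed.

(** The absolute value is rounded down and the sign kept, with index [k * m + q] or [k * m - q]. As
    no entry grows in modulus, rounding keeps a vector inside the unit ball. *)
Lemma round_toward_zero (R : realType) (k m : nat) (x : R) :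
  (0 < m)%N -> `|x| <= k%:R ->
  exists v : 'I_(2 * k * m).+1,
    `|gridval R k m v| <= `|x| /\ `|x - gridval R k m v| <= m%:R^-1.
Proof.
move=> m0 xk; have mR : 0 < m%:R :> R by rewrite ltr0n.
have y0 : 0 <= `|x| * m%:R by rewrite mulr_ge0.
have /andP[] := truncn_itv y0; set q := Num.truncn _ => q1 q2.
have qk : (q <= k * m)%N.
  by rewrite -(ler_nat R) (le_trans q1)// natrM ler_wpM2r.
move: q1; rewrite -ler_pdivrMr// => q1.
move: q2; rewrite -ltr_pdivlMr// -natr1 mulrDl mul1r => q2.
have q0 : 0 <= q%:R / m%:R :> R by rewrite divr_ge0.
have [x0|x0] := leP 0 x.
  have vN : (k * m + q < (2 * k * m).+1)%N by lia.
  exists (Ordinal vN); rewrite /gridval/= natrD natrM mulrDl mulfK ?gt_eqF//.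
  rewrite [_ - k%:R]addrAC subrr add0r.
  move: q1 q2; rewrite (ger0_norm x0) (ger0_norm q0) => q1 q2.
  by split => //; rewrite ler_norml; apply/andP; split; lra.
have vN : (k * m - q < (2 * k * m).+1)%N by lia.
exists (Ordinal vN); rewrite /gridval/= natrB// natrM mulrBl mulfK ?gt_eqF//.
rewrite [_ - k%:R]addrAC subrr add0r normrN.
move: q1 q2; rewrite (ltr0_norm x0) (ger0_norm q0) => q1 q2.
by split => //; rewrite ler_norml; apply/andP; split; lra.
Qed.

(** The bad events quantify over uncountably many real vectors; a measurable superset of small
    probability spares any proof that they are measurable. *)
Definition outer_prob_le (R : realType) d (T : measurableType d)
    (P : probability T R) (A : set T) (e : R) : Prop :=
  exists W, [/\ measurable W, A `<=` W & fine (P W) <= e].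

Lemma outer_prob_leW (R : realType) d (T : measurableType d)
    (P : probability T R) (A B : set T) (e f : R) :
  A `<=` B -> e <= f -> outer_prob_le P B e -> outer_prob_le P A f.
Proof.
move=> AB ef [W [mW BW PW]]; exists W; split => //.
  exact: subset_trans AB BW.
exact: le_trans PW ef.
Qed.

Lemma outer_prob_le_bigcup (R : realType) d (T : measurableType d)
    (P : probability T R) (X : finType) (Q : pred X) (A : X -> set T)
    (e : X -> R) :
  (forall x, Q x -> outer_prob_le P (A x) (e x)) ->
  outer_prob_le P [set w | exists2 x, Q x & A x w] (\sum_(x | Q x) e x).
Proof.
move=> hA.
suff [W [mW AW PW]] : exists W, [/\ measurable W,
    forall x, x \in index_enum X -> Q x -> A x `<=` W
    & fine (P W) <= \sum_(x <- index_enum X | Q x) e x].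
  exists W; split => // w [x Qx Axw].
  by apply: (AW x) => //; rewrite mem_index_enum.
elim: (index_enum X) => [|x s [W [mW AW PW]]].
  by exists set0; split => //; rewrite big_nil measure0.
rewrite big_cons; case: ifPn => Qx; last first.
  exists W; split => // y; rewrite inE => /predU1P[->|ys] Qy; last exact: AW.
  by rewrite Qy in Qx.
have [V [mV AV PV]] := hA x Qx.
exists (V `|` W); split; first exact: measurableU.
- move=> y; rewrite inE => /predU1P[->|ys] Qy.
    exact: subset_trans AV (@subsetUl _ _ _).
  exact: subset_trans (AW _ ys Qy) (@subsetUr _ _ _).
- apply: le_trans (lerD PV PW).
  rewrite -lee_fin EFinD !fineK ?fin_num_measure//; last exact: measurableU.
  exact: measureU2.
Qed.

Lemma outer_prob_leU (R : realType) d (T : measurableType d)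
    (P : probability T R) (A B : set T) (e f : R) :
  outer_prob_le P A e -> outer_prob_le P B f -> outer_prob_le P (A `|` B) (e + f).
Proof.
move=> [V [mV AV PV]] [W [mW BW PW]].
exists (V `|` W); split; [exact: measurableU|exact: setUSS|].
apply: le_trans (lerD PV PW).
rewrite -lee_fin EFinD !fineK ?fin_num_measure//; last exact: measurableU.
exact: measureU2.
Qed.

Section iid_normal.
Context (R : realType) d (T : measurableType d) (P : probability T R).
Context (I : finType) (Y : I -> {RV P >-> R}).
Hypothesis iidY : iid_standard_normal Y.

(** Mutual independence enters the whole argument through this product rule alone. *)
Lemma outer_prob_le_box (B : I -> set R) : (forall i, measurable (B i)) ->
  outer_prob_le P [set w | forall i, B i (Y i w)] (\prod_i nprob 0 (B i)).
Proof.
move=> mB; exists (\bigcap_(i in [set` [set: I]%SET]) (Y i @^-1` B i)); split.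
- apply: fin_bigcap_measurable; first exact: finite_finset.
  by move=> i _; rewrite -[_ @^-1` _]setTI; exact: measurable_funPT.
- by move=> w Bw i _; exact: Bw.
- rewrite iidY.1// (eq_bigr (fun i => (nprob 0 (B i))%:E)).
    by rewrite prodEFin/=; under eq_bigl do rewrite inE.
  by move=> i _; rewrite nprob_fin// -(iidY.2 i).
Qed.

Lemma outer_prob_le_tail (K : R) : 0 <= K ->
  outer_prob_le P [set w | exists i, K <= `|Y i w|]
    (#|I|%:R * (2 * expR (- (K ^+ 2 / 2)))).
Proof.
move=> K0.
have h (i : I) (B : set R) e : measurable B -> nprob 0 B <= e ->
    outer_prob_le P (Y i @^-1` B) e.
  move=> mB Be; exists (Y i @^-1` B); split => //.
    by rewrite -[_ @^-1` _]setTI; exact: measurable_funPT.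
  by have -> : P (Y i @^-1` B) = normal_prob 0 1 B by exact: iidY.2.
have [t1 t2] := nprob_tail K0.
rewrite mulr_natl -sumr_const.
apply: (outer_prob_leW _ _ (@outer_prob_le_bigcup _ _ _ P _ xpredT _ _
  (fun i _ => outer_prob_leU (h i _ _ _ t1) (h i _ _ _ t2)))) => //.
- move=> w [i Ki]; exists i => //.
  move: Ki; rewrite ler_normr => /orP[Ki|Ki]; [left|right] => /=.
    by rewrite in_itv/= Ki.
  by rewrite in_itv/= lerNr.
- by apply: ler_sum => i _; rewrite mulr2n mulrDl mul1r.
Qed.

End iid_normal.

(** * Tail and small ball estimates *)

Section linear_tail.
Context (R : realType) d (T : measurableType d) (P : probability T R).
Context (I : finType) (Y : I -> {RV P >-> R}).
Hypothesis iidY : iid_standard_normal Y.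

(* Chernoff's bound with the moment generating function replaced by the change
   of measure [nprob_shift], cell by cell. *)
Lemma outer_prob_le_linear (K m : nat) (a : I -> R) (s : R) :
  (0 < m)%N -> 0 <= s -> \sum_i a i ^+ 2 <= 1 ->
  outer_prob_le P
    [set w | (forall i, `|Y i w| <= K%:R) /\ s <= \sum_i a i * Y i w]
    (expR (s * (\sum_i `|a i|) / m%:R - s ^+ 2 / 2)).
Proof.
move=> m0 s0 a1; set E := expR _.
pose X := {ffun I -> 'I_(2 * K * m).+1}.
(* Only the cell patterns that meet the half-space are kept. *)
pose Q (c : X) := `[< exists g : I -> R,
  (forall i, cell R K m (c i) (g i)) /\ s <= \sum_i a i * g i >].
pose A (c : X) := [set w | forall i, cell R K m (c i) (Y i w)].
apply: (outer_prob_leW _ _ (@outer_prob_le_bigcup _ _ _ P X Q A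
  (fun c => \prod_i nprob 0 (cell R K m (c i))) _)).
- move=> w [wK ws].
  have /choice[c hc] := fun i => cell_cover m0 (wK i).
  exists (finfun c); last by move=> i; rewrite ffunE.
  by apply/asboolP; exists (Y^~ w); split => // i; rewrite ffunE.
- apply: (@le_trans _ _
    (\sum_(c | Q c) E * \prod_i nprob (s * a i) (cell R K m (c i)))).
    apply: ler_sum => c /asboolP[g [gc gs]].
    (* A lower bound for [s * a i * x] on the whole cell, since [x] lies within [1/m] of [g i]. *)
    pose b i := s * a i * g i - s * `|a i| / m%:R.
    apply: (@le_trans _ _ (\prod_i (expR ((s * a i) ^+ 2 / 2 - b i) *
        nprob (s * a i) (cell R K m (c i))))).
      apply: ler_prod => i _; rewrite nprob_ge0/=.
      rewrite -(ler_pM2l (expR_gt0 (b i))) mulrA -expRD.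
      rewrite [b i + _]addrC subrK; apply: nprob_shift.
        exact: measurable_cell.
      move=> x cx; rewrite /b lerBlDr -lerBlDl -mulrBr.
      apply: (le_trans (ler_norm _)); rewrite normrM normrM (ger0_norm s0).
      by rewrite ler_wpM2l ?mulr_ge0// (cell_dist (gc i) cx).
    rewrite big_split/= ler_wpM2r//.
      by apply: prodr_ge0 => i _; exact: nprob_ge0.
    (* The tilts cost at most [s^2 / 2] because the squares of [a] sum to at most 1, and the
       half-space gains [s^2]; the mesh accounts for the remaining term. *)
    rewrite -expR_sum ler_expR.
    have -> : \sum_i ((s * a i) ^+ 2 / 2 - b i) = s ^+ 2 * (\sum_i a i ^+ 2) / 2
        - s * (\sum_i a i * g i) + s * (\sum_i `|a i|) / m%:R.
      rewrite !mulr_sumr !mulr_suml -sumrB -big_split/=.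
      by apply: eq_bigr => i _; rewrite /b; ring.
    have h1 : s ^+ 2 * (\sum_i a i ^+ 2) <= s ^+ 2 * 1.
      by rewrite ler_wpM2l ?sqr_ge0.
    have h2 : s * s <= s * \sum_i a i * g i by rewrite ler_wpM2l.
    by move: h1 h2; rewrite -expr2; lra.
  rewrite -mulr_sumr ler_piMr ?expR_ge0//.
  (* Summed over all patterns, the products factor into one sum per coordinate, each at most 1 by
     disjointness of the cells. *)
  apply: (@le_trans _ _ (\sum_(c : X) \prod_i nprob (s * a i) (cell R K m (c i)))).
    rewrite [leRHS](bigID Q)/= lerDl; apply: sumr_ge0 => c _.
    by apply: prodr_ge0 => i _; exact: nprob_ge0.
  rewrite -(bigA_distr_bigA (fun i (v : 'I_(2 * K * m).+1) =>
    nprob (s * a i) (cell R K m v))).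
  apply: Num.Theory.prodr_ile1 => i _; apply/andP; split.
    by apply: sumr_ge0 => v _; exact: nprob_ge0.
  apply: sum_nprob_le1; last exact: trivIset_cell.
  by move=> v; exact: measurable_cell.
- move=> c _; apply: outer_prob_le_box => // i; exact: measurable_cell.
Qed.

End linear_tail.

Section small_ball.
Context (R : realType) d (T : measurableType d) (P : probability T R).
Context (k n : nat) (Y : 'I_k * 'I_n -> {RV P >-> R}).
Hypothesis iidY : iid_standard_normal Y.

(* The columns other than [j0] are frozen up to the mesh of the grid, so that
   only the independence of single entries is needed. *)
Lemma outer_prob_le_column (K m : nat) (j0 : 'I_n) (z : 'I_n -> R) (delta : R)
    (J : {set 'I_k}) :
  (0 < m)%N -> 0 <= delta ->
  outer_prob_le P
    [set w | (forall ij, `|Y ij w| <= K%:R) /\ forall i, i \in J ->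
      `|\sum_(l | l != j0) z l * Y (i, l) w - Y (i, j0) w| <= delta]
    ((2 * (delta + (\sum_l `|z l|) / m%:R)) ^+ #|J|).
Proof.
move=> m0 delta0; set e := delta + _.
have e0 : 0 <= e by rewrite addr_ge0// divr_ge0// sumr_ge0.
pose N := (2 * K * m).+1.
pose X := {ffun 'I_k * 'I_n -> 'I_N}.
(* Entries of column [j0] are not gridded; pinning their index to [ord0] avoids counting a pattern
   repeatedly. *)
pose Q (ij : 'I_k * 'I_n) (v : 'I_N) := (ij.2 == j0) ==> (v == ord0).
(* With the other columns moved to grid points, entry [(i, j0)] has to hit the fixed centre [b c i];
   the mesh term in [e] pays for the move. *)
pose b (c : X) i := \sum_(l | l != j0) z l * gridval R K m (c (i, l)).
pose B (c : X) (ij : 'I_k * 'I_n) : set R :=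
  if ij.2 == j0 then
    if ij.1 \in J then `[b c ij.1 - e, b c ij.1 + e]%classic else setT
  else cell R K m (c ij).
have mB c ij : measurable (B c ij).
  rewrite /B; case: ifP => _; last exact: measurable_cell.
  by case: ifP => _ //; exact: measurable_itv.
(* This majorant depends on the pattern only through the index at [ij], so the sum over patterns
   factors entry by entry. *)
pose F (ij : 'I_k * 'I_n) (v : 'I_N) : R :=
  if ij.2 == j0 then if ij.1 \in J then 2 * e else 1
  else nprob 0 (cell R K m v).
have F0 ij v : 0 <= F ij v.
  rewrite /F; do 2?case: ifP => _ //; last exact: nprob_ge0.
  by rewrite mulr_ge0.
apply: (outer_prob_leW _ _ (@outer_prob_le_bigcup _ _ _ P X
  (fun c => c \in family Q) (fun c => [set w | forall ij, B c ij (Y ij w)])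
  (fun c => \prod_ij nprob 0 (B c ij)) _)).
- move=> w [wK wJ].
  have /choice[c hc] := fun ij => cell_cover m0 (wK ij).
  pose c' : X := [ffun ij => if ij.2 == j0 then ord0 else c ij].
  exists c'; first by apply/familyP => ij; rewrite unfold_in /Q ffunE; case: eqP.
  move=> [i j]; rewrite /B/=; have [->|jj0] := eqVneq j j0; last first.
    by rewrite ffunE/= (negbTE jj0); exact: hc.
  case: ifPn => // iJ; rewrite /= in_itv/=.
  have : `|\sum_(l | l != j0) z l * Y (i, l) w - b c' i| <=
      (\sum_l `|z l|) / m%:R.
    rewrite -sumrB; apply: le_trans (ler_norm_sum _ _ _) _.
    rewrite mulr_suml [leRHS](bigID (fun l => l != j0))/= -[leLHS]addr0.
    apply: lerD; last by apply: sumr_ge0 => l _; rewrite mulr_ge0// invr_ge0.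
    apply: ler_sum => l lj0; rewrite -mulrBr normrM ler_wpM2l//.
    rewrite ffunE/= (negbTE lj0); apply: (cell_dist (hc _)).
    exact: cell_gridval.
  have := wJ i iJ; rewrite !ler_norml /e => /andP[h1 h2] /andP[h3 h4].
  by apply/andP; split; lra.
- apply: (@le_trans _ _ (\sum_(c in family Q) \prod_ij F ij (c ij))).
    apply: ler_sum => c _; apply: ler_prod => ij _; rewrite nprob_ge0/=.
    rewrite /B /F; case: ifP => // _; case: ifP => // _; last by rewrite nprobT.
    apply: (le_trans (nprob_itv_le _)); first by lra.
    by rewrite opprD addrACA subrr add0r opprK mulr2n mulrDl mul1r.
  rewrite -bigA_distr_big_dep.
  rewrite -(pair_bigA _ (fun i j => \sum_(v | Q (i, j) v) F (i, j) v))/=.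
  apply: (@le_trans _ _ (\prod_(i < k) (if i \in J then 2 * e else 1))).
    apply: ler_prod => i _; apply/andP; split.
      by apply: prodr_ge0 => j _; apply: sumr_ge0.
    rewrite (bigD1 j0)//= -[leRHS]mulr1; apply: ler_pM => //.
    + exact: sumr_ge0.
    + by apply: prodr_ge0 => j _; apply: sumr_ge0.
    + rewrite (bigD1 ord0)/=; last by rewrite /Q/= eqxx.
      rewrite big1 ?addr0 => [|v /andP[]]; last first.
        by rewrite /Q/= eqxx => /= /eqP -> /eqP.
      by rewrite /F/= eqxx.
    + apply: Num.Theory.prodr_ile1 => j jj0; rewrite sumr_ge0//=.
      apply: le_trans (_ : \sum_(v < N) nprob 0 (cell R K m v) <= 1).
        rewrite [leRHS](bigID (Q (i, j)))/= -[leLHS]addr0; apply: lerD.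
          by apply: ler_sum => v _; rewrite /F/= (negbTE jj0).
        by apply: sumr_ge0 => v _; exact: nprob_ge0.
      apply: sum_nprob_le1; last exact: trivIset_cell.
      by move=> v; exact: measurable_cell.
  by rewrite -big_mkcond/= prodr_const.
- by move=> c _; apply: outer_prob_le_box.
Qed.

End small_ball.

(** * Nets for the operator norm and for sparse combinations *)

Lemma sum_norm_abs_le1 (R : realType) (I : finType) (u : I -> R) i :
  \sum_i u i ^+ 2 <= 1 -> `|u i| <= 1.
Proof.
move=> u1; rewrite -(@ler_pXn2r _ 2)// ?nnegrE// expr1n.
rewrite -normrX ger0_norm ?sqr_ge0//; apply: le_trans u1.
by rewrite (bigD1 i)//= lerDl; apply: sumr_ge0 => j _; exact: sqr_ge0.
Qed.

Section nets.
Context (R : realType) d (T : measurableType d) (P : probability T R).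
Context (k n : nat) (Y : 'I_k * 'I_n -> {RV P >-> R}).
Hypothesis iidY : iid_standard_normal Y.

(** Round [u] and [x] toward zero on the grid of mesh [1/m] in [[-1, 1]], which has [2 * m + 1]
    points. Each product [u i * x j] changes by at most [2/m], whence the additive correction, and
    the rounded products still have square sum at most 1, so the linear tail bound applies to each
    of the finitely many pairs. *)
Lemma outer_prob_le_bilinear (K m : nat) (s : R) : (0 < m)%N -> 0 <= s ->
  outer_prob_le P
    [set w | (forall ij, `|Y ij w| <= K%:R) /\
      exists u x, [/\ \sum_i u i ^+ 2 <= 1, \sum_j x j ^+ 2 <= 1 &
        s + (k * n)%:R * (2 * K%:R / m%:R) <=
          \sum_ij u ij.1 * x ij.2 * Y ij w]]
    ((2 * m).+1%:R ^+ (k + n) *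
      expR (s * (k * n)%:R / m%:R - s ^+ 2 / 2)).
Proof.
move=> m0 s0; pose N := (2 * 1 * m).+1; pose g (v : 'I_N) : R := gridval R 1 m v.
pose X := ({ffun 'I_k -> 'I_N} * {ffun 'I_n -> 'I_N})%type.
pose sq (I : finType) (f : I -> 'I_N) := \sum_i g (f i) ^+ 2 <= 1.
pose Q (c : X) := sq _ c.1 && sq _ c.2.
pose a (c : X) (ij : 'I_k * 'I_n) := g (c.1 ij.1) * g (c.2 ij.2).
have aS c : Q c -> \sum_ij a c ij ^+ 2 <= 1.
  move=> /andP[c1 c2]; under eq_bigr do rewrite /a exprMn.
  rewrite -(pair_bigA _ (fun i j => g (c.1 i) ^+ 2 * g (c.2 j) ^+ 2))/=.
  under eq_bigr do rewrite -mulr_sumr.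
  rewrite -mulr_suml; apply: mulr_ile1 => //; apply: sumr_ge0 => *; exact: sqr_ge0.
apply: (outer_prob_leW _ _ (@outer_prob_le_bigcup _ _ _ P X Q
  (fun c => [set w | (forall ij, `|Y ij w| <= K%:R) /\
     s <= \sum_ij a c ij * Y ij w])
  (fun c => expR (s * (\sum_ij `|a c ij|) / m%:R - s ^+ 2 / 2)) _)).
- move=> w [wK [u [x [u1 x1 h]]]].
  have /choice[cu hcu] i : exists v : 'I_N, `|g v| <= `|u i| /\
      `|u i - g v| <= m%:R^-1.
    by apply: round_toward_zero => //; exact: sum_norm_abs_le1.
  have /choice[cx hcx] j : exists v : 'I_N, `|g v| <= `|x j| /\
      `|x j - g v| <= m%:R^-1.
    by apply: round_toward_zero => //; exact: sum_norm_abs_le1.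
  have sqP (I : finType) (f : I -> 'I_N) (y : I -> R) :
      (forall i, `|g (f i)| <= `|y i|) -> \sum_i y i ^+ 2 <= 1 ->
      sq _ (finfun f).
    move=> fy; apply: le_trans; apply: ler_sum => i _; rewrite ffunE.
    rewrite -[_ ^+ 2]real_normK ?num_real// -[leRHS]real_normK ?num_real//.
    by rewrite lerXn2r.
  exists (finfun cu, finfun cx).
    rewrite /Q /= (sqP _ _ u)/= ?(sqP _ _ x)// => i.
      by case: (hcx i).
    by case: (hcu i).
  split => //; rewrite -(lerD2r ((k * n)%:R * (2 * K%:R / m%:R))).
  apply: (le_trans h); rewrite -lerBlDl -sumrB.
  apply: (@le_trans _ _ (\sum_(ij : 'I_k * 'I_n) (2 * K%:R / m%:R : R))).
    apply: ler_sum => -[i j] _; rewrite /a /= !ffunE -mulrBl.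
    apply: (le_trans (ler_norm _)); rewrite normrM [leRHS]mulrAC.
    apply: ler_pM => //.
    have -> : u i * x j - g (cu i) * g (cx j) =
      u i * (x j - g (cx j)) + (u i - g (cu i)) * g (cx j) by ring.
    apply: (le_trans (ler_normD _ _)); rewrite !normrM mulrDl !mul1r.
    have [_ h1] := hcu i; have [h2 h3] := hcx j; apply: lerD.
      by rewrite -[leRHS]mul1r ler_pM// sum_norm_abs_le1.
    by rewrite -[leRHS]mulr1 ler_pM// (le_trans h2)// sum_norm_abs_le1.
  by rewrite sumr_const card_prod !card_ord -[leLHS]mulr_natl.
- apply: (@le_trans _ _ (\sum_(c : X) expR (s * (k * n)%:R / m%:R - s ^+ 2 / 2))).
    rewrite [leRHS](bigID Q)/= -[leLHS]addr0; apply: lerD; last first.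
      by apply: sumr_ge0 => c _; exact: expR_ge0.
    apply: ler_sum => c Qc; rewrite ler_expR lerD2r ler_wpM2r ?invr_ge0//.
    rewrite ler_wpM2l//.
    apply: (@le_trans _ _ (\sum_(ij : 'I_k * 'I_n) (1 : R))).
      by apply: ler_sum => ij _; apply: sum_norm_abs_le1; exact: aS.
    by rewrite sumr_const card_prod !card_ord.
  rewrite sumr_const card_prod !card_ffun !card_ord -expnD -[leLHS]mulr_natl natrX.
  by rewrite /N muln1.
- by move=> c Qc; apply: outer_prob_le_linear => //; exact: aS.
Qed.

(** Duality: if [x] is stretched too much, then [x] and its image, both normalised, make the
    bilinear form large. *)
Lemma outer_prob_le_opnorm (K m : nat) (s : R) : (0 < m)%N -> 0 <= s ->
  outer_prob_le P
    [set w | (forall ij, `|Y ij w| <= K%:R) /\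
      exists x : 'I_n -> R,
        (s + (k * n)%:R * (2 * K%:R / m%:R)) ^+ 2 * \sum_j x j ^+ 2 <
          \sum_i (\sum_j x j * Y (i, j) w) ^+ 2]
    ((2 * m).+1%:R ^+ (k + n) *
      expR (s * (k * n)%:R / m%:R - s ^+ 2 / 2)).
Proof.
move=> m0 s0; apply: outer_prob_leW (lexx _) (outer_prob_le_bilinear K m0 s0).
move=> w [wK [x hx]]; split => //; set S := s + _ in hx *.
have S0 : 0 <= S by rewrite addr_ge0// mulr_ge0// divr_ge0// mulr_ge0.
pose v i := \sum_j x j * Y (i, j) w.
set V := \sum_(i < k) _ in hx; set X2 := \sum_(j < n) _ in hx.
have X0 : 0 <= X2 by apply: sumr_ge0 => *; exact: sqr_ge0.
have V0 : 0 < V by apply: le_lt_trans hx; rewrite mulr_ge0// sqr_ge0.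
(* For [x = 0] both sides of [hx] would vanish, so normalisation is legitimate. *)
have X20 : 0 < X2.
  rewrite lt_def X0 andbT; apply/eqP => X20.
  suff : V = 0 by move=> VE; rewrite VE ltxx in V0.
  have x0 j : x j = 0.
    apply/eqP; rewrite -sqrf_eq0.
    have /eqP := X20; rewrite psumr_eq0 => [/allP/(_ j)|*]; last exact: sqr_ge0.
    by rewrite mem_index_enum; apply.
  rewrite /V big1// => i _; rewrite big1 ?expr0n// => j _.
  by rewrite x0 mul0r.
have sV : 0 < Num.sqrt V by rewrite sqrtr_gt0.
have sX : 0 < Num.sqrt X2 by rewrite sqrtr_gt0.
exists (fun i => v i / Num.sqrt V), (fun j => x j / Num.sqrt X2); split.
- under eq_bigr do rewrite expr_div_n sqr_sqrtr ?(ltW V0)//.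
  by rewrite -mulr_suml divff// gt_eqF.
- under eq_bigr do rewrite expr_div_n sqr_sqrtr ?(ltW X20)//.
  by rewrite -mulr_suml divff// gt_eqF.
- have -> : \sum_(ij : 'I_k * 'I_n) v ij.1 / Num.sqrt V *
      (x ij.2 / Num.sqrt X2) * Y ij w = Num.sqrt V / Num.sqrt X2.
    rewrite (eq_bigr (fun ij => v ij.1 / Num.sqrt V *
      (x ij.2 / Num.sqrt X2) * Y (ij.1, ij.2) w)); last by case.
    rewrite -(pair_bigA _ (fun i j => v i / Num.sqrt V *
      (x j / Num.sqrt X2) * Y (i, j) w))/=.
    rewrite (eq_bigr (fun i => v i ^+ 2 * ((Num.sqrt V)^-1 / Num.sqrt X2))).
      rewrite -mulr_suml -[X in X * _](sqr_sqrtr (ltW V0)) expr2.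
      by field; rewrite !gt_eqF.
    move=> i _; rewrite expr2 {3}/v mulr_sumr mulr_suml.
    by apply: eq_bigr => j _; ring.
  rewrite ler_pdivlMr// -(@ler_pXn2r _ 2)// ?nnegrE ?sqrtr_ge0//.
    by rewrite exprMn !sqr_sqrtr ?ltW.
  by rewrite mulr_ge0 ?sqrtr_ge0.
Qed.

(** A small total residual leaves at least half of the rows with residual at most [delta]. The union
    bound runs over the column [j0], the rounded sparse vector and the set of good rows; for each
    choice [outer_prob_le_column] gives one small factor per good row. *)
Lemma outer_prob_le_sparse (K m r : nat) (delta : R) :
  (0 < m)%N -> 0 < delta -> 2 * (delta + 2 * (r%:R * K%:R / m%:R)) <= 1 ->
  outer_prob_le P
    [set w | (forall ij, `|Y ij w| <= K%:R) /\
      exists (j0 : 'I_n) (y : 'I_n -> R), [/\ y j0 = 0,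
        (#|[set l | y l != 0%R]%SET| <= r)%N, forall l, `|y l| <= K%:R &
        \sum_i (\sum_l y l * Y (i, l) w - Y (i, j0) w) ^+ 2 <=
          delta ^+ 2 * (k%:R / 2)]]
    (n%:R * (n * (2 * K * m).+1)%:R ^+ r * 2 ^+ k *
      (2 * (delta + 2 * (r%:R * K%:R / m%:R))) ^+ k./2).
Proof.
move=> m0 delta0; set b := 2 * _ => b1.
pose N := (2 * K * m).+1; pose g (v : 'I_N) : R := gridval R K m v.
have gK v : `|g v| <= K%:R.
  rewrite /g /gridval ler_norml lerBrDr addrC subrr divr_ge0//= lerBlDr.
  rewrite ler_pdivrMr ?ltr0n// -natrD -natrM ler_nat.
  by have := ltn_ord v; rewrite /N ltnS; lia.
have mV : 0 < m%:R^-1 :> R by rewrite invr_gt0 ltr0n.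
(* [phi] lists the support of a sparse grid vector together with its values;
   the entries of [phi] pointing at [j0] are padding. *)
pose X := ('I_n * {ffun 'I_r -> 'I_n * 'I_N} * {set 'I_k})%type.
pose z (phi : {ffun 'I_r -> 'I_n * 'I_N}) l :=
  \sum_(a | (phi a).1 == l) g (phi a).2.
(* This error is paid twice: for rounding the [r] entries of [y] against entries of size [K], and
   for freezing the other columns against coefficients of total size [r * K]. *)
pose e1 : R := r%:R * K%:R / m%:R.
have e10 : 0 <= e1 by rewrite !mulr_ge0// ltW.
pose Q (c : X) := (k./2 <= #|c.2|)%N.
pose A (c : X) := [set w | (forall ij, `|Y ij w| <= K%:R) /\
  forall i, i \in c.2 ->
    `|\sum_(l | l != c.1.1) z c.1.2 l * Y (i, l) w - Y (i, c.1.1) w| <=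
      delta + e1].
have zK phi : \sum_l `|z phi l| <= r%:R * K%:R.
  apply: (@le_trans _ _ (\sum_l \sum_(a | (phi a).1 == l) `|g (phi a).2|)).
    by apply: ler_sum => l _; exact: ler_norm_sum.
  rewrite (exchange_big_dep xpredT)//=.
  apply: (@le_trans _ _ (\sum_(a < r) K%:R)).
    by apply: ler_sum => a _; rewrite (big_pred1 (phi a).1)// => l /=; rewrite eq_sym.
  by rewrite sumr_const card_ord mulr_natl.
apply: (outer_prob_leW _ _ (@outer_prob_le_bigcup _ _ _ P X Q A
  (fun c => (2 * (delta + e1 + (\sum_l `|z c.1.2 l|) / m%:R)) ^+ #|c.2|) _)).
- move=> w [wK [j0 [y [yj0 ysupp yK hy]]]].
  have /choice[v hv] l : exists u : 'I_N, `|y l - g u| <= m%:R^-1.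
    by have [u []] := round_toward_zero m0 (yK l); exists u.
  pose s := enum [set l | y l != 0%R]%SET.
  (* Positions beyond the support default to [j0], which is not in [s] as [y j0 = 0] and whose
     coefficient the sums below never read. *)
  pose phi := [ffun a : 'I_r => (nth j0 s a, v (nth j0 s a))].
  have sr : (size s <= r)%N by rewrite -cardE.
  have zE l : l != j0 -> z phi l = if y l != 0 then g (v l) else 0.
    move=> lj0; rewrite /z; case: ifPn => yl.
      have ls : l \in s by rewrite mem_enum inE.
      have ir : (index l s < r)%N by rewrite (leq_trans _ sr)// index_mem.
      rewrite (bigD1 (Ordinal ir))/= ffunE/= nth_index//.
      rewrite big1 ?addr0// => a /andP[]; rewrite ffunE/= => /eqP al /eqP na.
      case: na; apply/val_inj; rewrite /= -al index_uniq ?enum_uniq//.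
      by rewrite ltnNge; apply/negP => sa; rewrite nth_default// in al;
        rewrite al eqxx in lj0.
    rewrite big1// => a; rewrite ffunE/= => /eqP al.
    have [sa|sa] := leqP (size s) a.
      by rewrite nth_default// in al; rewrite al eqxx in lj0.
    have := mem_nth j0 sa; rewrite al mem_enum inE => yl'.
    by rewrite yl' in yl.
  pose D i := \sum_l y l * Y (i, l) w - Y (i, j0) w.
  pose J := [set i | `|D i| <= delta]%SET.
  exists (j0, phi, J).
    (* Markov's inequality: every row outside [J] contributes more than [delta^2]. *)
    rewrite /Q/=; have : #|~: J|%:R * delta ^+ 2 <= delta ^+ 2 * (k%:R / 2).
      apply: le_trans hy; rewrite [leRHS](bigID (fun i => i \in ~: J))/=.
      rewrite -[leLHS]addr0; apply: lerD; last first.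
        by apply: sumr_ge0 => i _; exact: sqr_ge0.
      rewrite mulr_natl -sumr_const; apply: ler_sum => i.
      rewrite !inE -ltNge -/(D i) => Di.
      by rewrite -[leRHS]real_normK ?num_real// lerXn2r// ?nnegrE ltW.
    rewrite mulrC ler_pM2l ?exprn_gt0// ler_pdivlMr// -natrM ler_nat.
    have := cardsC J; rewrite card_ord => kE cJ.
    rewrite -(doubleK #|J|); apply: half_leq; rewrite -muln2.
    by move: kE cJ; set a := #|J|; set b' := #|_|; lia.
  split => // i; rewrite inE/= => Di.
  have -> : \sum_(l | l != j0) z phi l * Y (i, l) w - Y (i, j0) w =
      D i + \sum_(l in [set l | y l != 0%R]%SET) (g (v l) - y l) * Y (i, l) w.
    rewrite /D addrAC; congr (_ - _).
    rewrite (bigID (fun l => y l != 0))/= [X in _ + X]big1 ?addr0; last first.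
      by move=> l /andP[lj0 yl]; rewrite zE// (negbTE yl) mul0r.
    rewrite [in RHS](bigID (fun l => y l != 0))/= [X in _ + X + _]big1 ?addr0.
      rewrite [X in _ + X](eq_bigl (fun l => y l != 0)) => [|l]; last by rewrite inE.
      rewrite -big_split/=; apply: eq_big => [l|l /andP[lj0 yl]].
        by case: eqVneq => [->|]//; rewrite yj0 eqxx.
      by rewrite zE// yl; ring.
    by move=> l; rewrite negbK => /eqP ->; rewrite mul0r.
  apply: (le_trans (ler_normD _ _)); apply: lerD => //.
  apply: (le_trans (ler_norm_sum _ _ _)).
  apply: (@le_trans _ _ (\sum_(l in [set l | y l != 0%R]%SET) m%:R^-1 * K%:R)).
    apply: ler_sum => l _; rewrite normrM ler_pM// distrC; exact: hv.
  rewrite sumr_const -[leLHS]mulr_natl [m%:R^-1 * _]mulrC mulrA /e1.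
  rewrite ler_wpM2r ?(ltW mV)//.
  by rewrite ler_wpM2r// ler_nat.
- apply: (@le_trans _ _ (\sum_(c : X) b ^+ k./2)).
    have b0 : 0 <= b.
      by rewrite mulr_ge0// addr_ge0// ?(ltW delta0)// mulr_ge0.
    rewrite [leRHS](bigID Q)/= -[leLHS]addr0; apply: lerD; last first.
      by apply: sumr_ge0 => c _; exact: exprn_ge0.
    apply: ler_sum => c Qc.
    (* Since [b <= 1], the exponent may then be lowered to [k./2], uniformly in the row set. *)
    apply: (@le_trans _ _ (b ^+ #|c.2|)).
      rewrite lerXn2r ?nnegrE//.
        by rewrite mulr_ge0// !addr_ge0// ?(ltW delta0)// mulr_ge0 ?sumr_ge0// ltW.
      rewrite /b ler_wpM2l// -addrA lerD2l mulr2n mulrDl mul1r -/e1 lerD2l.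
      by rewrite ler_wpM2r// ltW.
    by apply: ler_wiXn2l.
  rewrite sumr_const !card_prod card_ffun card_prod !card_ord.
  rewrite -(cardsT {set 'I_k}) -powersetT card_powerset cardsT card_ord.
  by rewrite -[leLHS]mulr_natl !natrM !natrX natrM.
- by move=> c Qc; apply: outer_prob_le_column => //; rewrite addr_ge0// ltW.
Qed.

End nets.

(** * Cost of a column *)

(** Split the exponent as [2 = (2 - p) + p]. Summed, this turns a bound on the p-norm and on the
    largest entry into a Euclidean bound. *)
Lemma sqr_le_powR (R : realType) (p c a : R) :
  0 < p < 2 -> `|a| <= c -> a ^+ 2 <= c `^ (2 - p) * `|a| `^ p.
Proof.
move=> /andP[p0 p2] ac; have [->|a0] := eqVneq a 0.
  by rewrite expr0n mulr_ge0// powR_ge0.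
have na : 0 < `|a| by rewrite normr_gt0.
rewrite -[leLHS]real_normK ?num_real// -powR_mulrn//.
rewrite -[X in _ `^ X](subrK p) powRD ?(gt_eqF na) ?implybT//.
have c0 : 0 <= c := le_trans (normr_ge0 a) ac.
rewrite ler_wpM2r ?powR_ge0//.
by apply: ge0_ler_powR; rewrite ?nnegrE ?subr_ge0// ltW.
Qed.

Lemma sum_sqr_le_powR (R : realType) (I : finType) (p c : R) (a : I -> R) :
  0 < p < 2 -> (forall i, `|a i| <= c) ->
  \sum_i a i ^+ 2 <= c `^ (2 - p) * \sum_i `|a i| `^ p.
Proof.
by move=> hp ac; rewrite mulr_sumr; apply: ler_sum => i _; exact: sqr_le_powR.
Qed.

Lemma powR_term_le (R : realType) (I : finType) (p t : R) (a : I -> R) i :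
  0 < p -> 0 <= t -> \sum_i `|a i| `^ p <= t `^ p -> `|a i| <= t.
Proof.
move=> p0 t0 h; rewrite leNgt; apply/negP => ti.
have : t `^ p < `|a i| `^ p by apply: gt0_ltr_powR; rewrite ?nnegrE.
apply/negP; rewrite -leNgt; apply: le_trans h.
by rewrite (bigD1 i)//= lerDl; apply: sumr_ge0 => j _; exact: powR_ge0.
Qed.

(* A cheap coefficient vector [y] splits into its at most [r] entries above
   [theta], whose image stays far from column [j], and a remainder of small
   Euclidean norm, whose image is controlled by the operator norm [S]. *)
Lemma column_cost_ge (R : realType) (p t theta S rho2 : R) (k n r K : nat)
    (A : 'M[R]_(k, n)) :
  1 < p < 2 -> 0 < t <= K%:R -> 0 < theta ->
  t `^ p <= r.+1%:R * theta `^ p ->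
  2 * (t ^+ 2 + S ^+ 2 * (theta `^ (2 - p) * t `^ p)) <= rho2 ->
  (forall x : 'I_n -> R, \sum_i (\sum_l x l * A i l) ^+ 2 <=
    S ^+ 2 * \sum_l x l ^+ 2) ->
  (forall (j : 'I_n) (y : 'I_n -> R), y j = 0 ->
    (#|[set l | y l != 0%R]%SET| <= r)%N -> (forall l, `|y l| <= K%:R) ->
    rho2 < \sum_i (\sum_l y l * A i l - A i j) ^+ 2) ->
  forall (j : 'I_n) (y : 'I_n -> R), y j = 0 ->
    t `^ p <= \sum_i `|\sum_l A i l * y l - A i j| `^ p + \sum_l `|y l| `^ p.
Proof.
move=> /andP[p1 p2] /andP[t0 tK] th0 hr hrho hS hsp j y yj.
have p0 : 0 < p by lra.
have p02 : 0 < p < 2 by rewrite p0.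
rewrite leNgt; apply/negP => hlt.
pose D i := \sum_l A i l * y l - A i j.
have sD : \sum_i `|D i| `^ p <= t `^ p.
  apply: ltW; apply: le_lt_trans hlt.
  by rewrite lerDl sumr_ge0// => *; exact: powR_ge0.
have sy : \sum_l `|y l| `^ p < t `^ p.
  by apply: le_lt_trans hlt; rewrite lerDr sumr_ge0// => *; exact: powR_ge0.
have yt l : `|y l| <= t.
  by apply: (@powR_term_le _ _ p _ y l _ _ (ltW sy)) => //; exact: ltW.
have Dt i : `|D i| <= t.
  by apply: (@powR_term_le _ _ p _ D i _ _ sD) => //; exact: ltW.
have D2 : \sum_i D i ^+ 2 <= t ^+ 2.
  apply: (le_trans (sum_sqr_le_powR p02 Dt)).
  apply: (@le_trans _ _ (t `^ (2 - p) * t `^ p)).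
    by rewrite ler_wpM2l// powR_ge0.
  by rewrite -powRD ?(gt_eqF t0) ?implybT// subrK powR_mulrn// ltW.
pose z l := if theta < `|y l| then y l else 0.
pose h l := if theta < `|y l| then 0 else y l.
have h2 : \sum_l h l ^+ 2 <= theta `^ (2 - p) * t `^ p.
  apply: (@le_trans _ _ (theta `^ (2 - p) * \sum_l `|h l| `^ p)).
    apply: sum_sqr_le_powR => // l; rewrite /h; case: ltP => //.
    by rewrite normr0 ltW.
  rewrite ler_wpM2l ?powR_ge0//; apply: le_trans (ltW sy).
  apply: ler_sum => l _; rewrite /h; case: ifP => // _.
  by rewrite normr0 powR0 ?gt_eqF// powR_ge0.
(* More than [r] entries above [theta] would already cost [r.+1 * theta^p], which is at least [t^p],
   against the strict bound [sy]. *)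
have zsupp : (#|[set l | z l != 0%R]%SET| <= r)%N.
  rewrite -ltnS -(ltr_nat R) -(ltr_pM2r (powR_gt0 p th0)).
  apply: lt_le_trans hr; apply: le_lt_trans sy.
  rewrite mulr_natl -sumr_const.
  rewrite [leRHS](bigID (fun l => l \in [set l | z l != 0%R]%SET))/=.
  rewrite -[leLHS]addr0; apply: lerD; last first.
    by apply: sumr_ge0 => *; exact: powR_ge0.
  apply: ler_sum => l; rewrite inE /z; case: ltP => [tl _|_]; last by rewrite eqxx.
  by rewrite ge0_ler_powR ?nnegrE// ltW.
have zj : z j = 0 by rewrite /z yj; case: ifP.
have zK l : `|z l| <= K%:R.
  by rewrite /z; case: ifP => _; rewrite ?normr0// (le_trans (yt l)).
have := hsp j z zj zsupp zK; apply/negP; rewrite -leNgt.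
apply: le_trans hrho.
have zE i : \sum_l z l * A i l - A i j = D i - \sum_l h l * A i l.
  rewrite /D addrAC -sumrB; congr (_ - _); apply: eq_bigr => l _.
  by rewrite /z /h; case: ifP => _; ring.
apply: (@le_trans _ _ (2 * (\sum_i D i ^+ 2 + \sum_i (\sum_l h l * A i l) ^+ 2))).
  rewrite -big_split/= mulr_sumr; apply: ler_sum => i _; rewrite zE.
  set u := D i; set v := \sum_l _.
  by have := sqr_ge0 (u + v); rewrite !expr2; lra.
rewrite ler_wpM2l//; apply: lerD => //.
by apply: (le_trans (hS h)); rewrite ler_wpM2l ?sqr_ge0.
Qed.

(** * Choice of parameters *)

(** Everything is compared with [v = k^(gam/2)]: once [v] exceeds a constant [W], any quantity below
    [W * v] is below [v^2 = k^gam]. *)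
Lemma eventually_powR_large (R : realType) (c gam C0 M : R) :
  1 <= c -> 0 < gam -> 0 < C0 ->
  exists k0 : nat, forall k : nat, (k0 <= k)%N ->
    [/\ (9 <= k)%N, M <= k%:R `^ gam, C0 * ln k%:R `^ c <= k%:R `^ gam,
        28 * ln k%:R + 4 <= k%:R `^ gam & 24 / gam <= ln (k%:R : R)].
Proof.
move=> c1 g0 C00; have c0 : 0 < c by lra.
(* The second term comes from [lnP] at exponent [gam / (2 * c)], the third from [28 * ln k] at
   exponent [gam / 2]. *)
pose W := 5 + C0 * (2 * c / gam) `^ c + 56 / gam + `|M|.
have W1 : 0 <= C0 * (2 * c / gam) `^ c by rewrite mulr_ge0 ?powR_ge0// ltW.
have W2 : 0 <= 56 / gam by rewrite divr_ge0// ltW.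
have W0 : 0 < W by have := normr_ge0 M; rewrite /W; lra.
exists (9 + (Num.truncn (W `^ (2 / gam) + expR (24 / gam))).+1)%N => k hk.
have k9 : (9 <= k)%N by rewrite (leq_trans _ hk)// leq_addr.
have kR : 9 <= k%:R :> R by rewrite ler_nat.
have k0 : 0 < k%:R :> R by lra.
have kge : W `^ (2 / gam) + expR (24 / gam) <= k%:R :> R.
  have := truncnS_gt (W `^ (2 / gam) + expR (24 / gam)).
  move=> /ltW /le_trans; apply; rewrite ler_nat.
  by rewrite (leq_trans _ hk)// leq_addl.
have kW : W `^ (2 / gam) <= k%:R by apply: le_trans kge; rewrite lerDl expR_ge0.
have ke : expR (24 / gam) <= k%:R by apply: le_trans kge; rewrite lerDr powR_ge0.
have lnP e : 0 < e -> ln k%:R <= e^-1 * k%:R `^ e :> R.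
  move=> e0; rewrite -(ler_pM2l e0) mulrA divff ?gt_eqF// mul1r -ln_powR ltW//.
  by apply: ln_sublinear; exact: powR_gt0.
pose v : R := k%:R `^ (gam / 2).
have vW : W <= v.
  have -> : W = (W `^ (2 / gam)) `^ (gam / 2).
    rewrite -powRrM (_ : 2 / gam * (gam / 2) = 1) ?powRr1 ?ltW//.
    by field; rewrite gt_eqF.
  by apply: ge0_ler_powR; rewrite ?nnegrE ?powR_ge0 ?divr_ge0 ?(ltW g0).
have v1 : 1 <= v by apply: le_trans vW; have := normr_ge0 M; rewrite /W; lra.
have uE : k%:R `^ gam = v * v.
  rewrite -powRD; last by rewrite (gt_eqF k0) implybT.
  by congr (_ `^ _); field.
have Wv : W * v <= v * v by rewrite ler_wpM2r//; lra.
have L0 : 0 <= ln k%:R :> R by rewrite ln_ge0//; lra.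
have M0 := normr_ge0 M.
split => //.
- rewrite uE; apply: le_trans Wv; apply: (@le_trans _ _ W).
    by have := ler_norm M; rewrite /W; lra.
  by rewrite ler_peMr// ltW.
- rewrite uE; apply: le_trans Wv.
  apply: (@le_trans _ _ (C0 * (2 * c / gam) `^ c * v)).
    rewrite -mulrA ler_wpM2l ?(ltW C00)//.
    have e0 : 0 < gam / (2 * c) by rewrite divr_gt0// mulr_gt0.
    apply: (@le_trans _ _ (((gam / (2 * c))^-1 * k%:R `^ (gam / (2 * c))) `^ c)).
      apply: ge0_ler_powR; rewrite ?nnegrE//.
      - exact: ltW.
      - by rewrite mulr_ge0 ?powR_ge0// invr_ge0 ltW.
      - exact: lnP.
    rewrite [leLHS]powRM ?powR_ge0 ?invr_ge0 ?(ltW e0)// -powRrM invf_div.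
    rewrite (_ : gam / (2 * c) * c = gam / 2)//.
    by field; rewrite gt_eqF.
  by rewrite ler_wpM2r ?(le_trans _ v1)//; rewrite /W; lra.
- rewrite uE; apply: le_trans Wv.
  have := lnP (gam / 2); rewrite divr_gt0// invf_div => /(_ isT) h.
  apply: (@le_trans _ _ (28 * (2 / gam * v) + 4 * v)).
    by apply: lerD; [rewrite ler_wpM2l|rewrite ler_peMr].
  rewrite mulrA -mulrDl ler_wpM2r ?(le_trans _ v1)//.
  by rewrite /W; move: W1 M0; lra.
- by rewrite -ler_expR lnK// posrE.
Qed.

Section bounds.
Context (R : realType) (gam : R) (k n : nat).
Let L : R := ln k%:R.
Let u : R := k%:R `^ gam.
Hypothesis gam01 : 0 < gam <= 2^-1.
Hypothesis k9 : (9 <= k)%N.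
Hypothesis kn : (k < n)%N.
Hypothesis n_le : n%:R <= k%:R * u.
Hypothesis Lu : 28 * L + 4 <= u.
Hypothesis gL : 24 / gam <= L.

(** The rounding errors below carry polynomial factors of order at most [k^4], so mesh [k^-6] makes
    them negligible. *)
Let m := (k ^ 6)%N.

Let k9R : 9 <= k%:R :> R. Proof. by rewrite ler_nat. Qed.
Let k0 : 0 < k%:R :> R. Proof. by have := k9R; lra. Qed.
Let knat_exp : k%:R = expR L. Proof. by rewrite lnK// posrE. Qed.

Let L48 : 48 <= L.
Proof.
case/andP: gam01 => g0 g1; apply: le_trans gL.
by rewrite ler_pdivlMr//; lra.
Qed.
Let L2_le : 2 * L <= k%:R.
Proof.
have h48 := L48.
rewrite knat_exp; have L0 : 0 <= L by lra.
apply: le_trans (expR_ge1Dxn 1 L0).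
rewrite (_ : 2`! = 2%N)//; have : 48 * L <= L * L by rewrite ler_wpM2r.
by rewrite expr2; lra.
Qed.

Let u4 : 4 <= u. Proof. by have := L48; have := Lu; lra. Qed.

Let u_exp : u = expR (gam * L).
Proof. by rewrite /u knat_exp mulrC expRM. Qed.

Let u2_le : u ^+ 2 <= k%:R.
Proof.
have h9 := k9R; have h48 := L48; have h4 := u4.
rewrite u_exp -expRM_natl knat_exp ler_expR.
have L0 : 0 <= L by lra.
case/andP: gam01 => g0 g1; rewrite mulrA -[leRHS]mul1r ler_wpM2r//; lra.
Qed.

Let n_le2 : n%:R <= k%:R ^+ 2 :> R.
Proof.
have h9 := k9R; have h48 := L48; have h4 := u4.
apply: (le_trans n_le); rewrite expr2 ler_wpM2l//.
by apply: le_trans u2_le; rewrite expr2 ler_peMr//; lra.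
Qed.

Let m_gt0 : (0 < m)%N. Proof. by rewrite expn_gt0 (leq_trans _ k9). Qed.

Let mE : m%:R = k%:R ^+ 6 :> R. Proof. by rewrite natrX. Qed.

Let k_div_m (q : nat) : (q <= 6)%N -> k%:R ^+ q / m%:R = k%:R ^- (6 - q) :> R.
Proof.
have h9 := k9R; have h48 := L48; have h4 := u4.
move=> q6; rewrite mE -{1}(subKn q6) exprB ?leq_subr// ?unitfE ?gt_eqF//.
by rewrite mulrAC divff ?mul1r// expf_neq0// gt_eqF.
Qed.

Lemma tail_bound :
  (k * n)%:R * (2 * expR (- (k%:R ^+ 2 / 2))) <= expR (- k%:R : R).
Proof.
have h9 := k9R; have h48 := L48; have h4 := u4.
apply: (@le_trans _ _ (expR (3 * L) * (expR 1 * expR (- (k%:R ^+ 2 / 2))))).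
  apply: ler_pM => //.
  - rewrite natrM expRM_natl -knat_exp exprS ler_wpM2l//; exact: n_le2.
  - by rewrite ler_wpM2r ?expR_ge0//; have := expR_ge1Dx (1 : R); lra.
rewrite -!expRD ler_expR.
have : 9 * k%:R <= k%:R ^+ 2 :> R by rewrite expr2 ler_wpM2r// ltW.
by have := L2_le; move: k9R; lra.
Qed.

(** The net has at most [expR (14 * n * L)] pairs, and [s^2 / 2 = n * u / 2] must beat this
    exponent; hence the requirement [28 * L + 4 <= u]. *)
Let s : R := Num.sqrt (n%:R * u).

Let s2E : s ^+ 2 = n%:R * u.
Proof. by rewrite sqr_sqrtr// mulr_ge0// powR_ge0. Qed.

Let s_ge0 : 0 <= s. Proof. exact: sqrtr_ge0. Qed.

Let s_le : s <= k%:R.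
Proof.
have h9 := k9R; have h48 := L48; have h4 := u4.
rewrite -(@ler_pXn2r _ 2)// ?nnegrE ?s_ge0// s2E.
apply: (@le_trans _ _ (k%:R * u * u)).
  by rewrite ler_wpM2r ?powR_ge0.
by rewrite -mulrA -!expr2 expr2 ler_wpM2l// u2_le.
Qed.

Let kn_le3 : (k * n)%:R <= k%:R ^+ 3 :> R.
Proof. by rewrite natrM exprS ler_wpM2l// n_le2. Qed.

Let s_ge1 : 1 <= s.
Proof.
have h9 := k9R; have h48 := L48; have h4 := u4.
rewrite -(@ler_pXn2r _ 2)// ?nnegrE ?s_ge0// s2E expr1n.
have n1 : 1 <= n%:R :> R by rewrite ler1n (leq_ltn_trans (leq0n k) kn).
by rewrite -[leLHS]mulr1 ler_pM//; lra.
Qed.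

Lemma opnorm_bound :
  (2 * m).+1%:R ^+ (k + n) *
      expR (s * (k * n)%:R / m%:R - s ^+ 2 / 2) <= expR (- k%:R).
Proof.
have h9 := k9R; have h48 := L48; have h4 := u4.
have hm : (2 * m).+1%:R <= expR (7 * L).
  rewrite expRM_natl -knat_exp -natrX ler_nat /m.
  rewrite [(k ^ 7)%N]expnS; apply: leq_trans (leq_mul k9 (leqnn _)).
  by move: m_gt0; rewrite /m; move: (k ^ 6)%N => a; clear; lia.
have e1 : s * (k * n)%:R / m%:R <= 1.
  apply: (@le_trans _ _ (k%:R ^+ 4 / m%:R)).
    by rewrite ler_wpM2r ?invr_ge0// exprS ler_pM ?s_ge0 ?s_le ?kn_le3.
  rewrite k_div_m// invf_le1 ?exprn_gt0// exprn_ege1//; lra.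
apply: (@le_trans _ _ (expR (7 * L * (n + n)%:R) * expR (1 - s ^+ 2 / 2))).
  apply: ler_pM => //.
  - rewrite expRM_natr; apply: (@le_trans _ _ (expR (7 * L) ^+ (k + n))).
      by rewrite lerXn2r// nnegrE ?expR_ge0.
    apply: ler_weXn2l; last by rewrite leq_add2r ltnW.
    by rewrite -expR0 ler_expR mulr_ge0//; move: L48; lra.
  - by rewrite ler_expR lerD2r.
rewrite -expRD ler_expR s2E natrD.
have kn' : k%:R <= n%:R :> R by rewrite ler_nat ltnW.
have : n%:R * (28 * L + 4) <= n%:R * u by rewrite ler_wpM2l.
by rewrite mulrDr [n%:R * (28 * L)]mulrCA; move: k9R; lra.
Qed.

(** The rounding correction is at most [1 <= s], so the norm is at most [2 * s]. *)
Lemma opnorm_const :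
  (s + (k * n)%:R * (2 * k%:R / m%:R)) ^+ 2 <= 4 * (k%:R * u ^+ 2).
Proof.
have h9 := k9R; have h48 := L48; have h4 := u4.
have h : (k * n)%:R * (2 * k%:R / m%:R) <= s.
  apply: le_trans s_ge1.
  apply: (@le_trans _ _ (2 * (k%:R ^+ 4 / m%:R))).
    rewrite -[2 * _ / _]mulrA mulrCA ler_wpM2l// mulrA ler_wpM2r ?invr_ge0//.
    by rewrite [k%:R ^+ 4]exprSr ler_wpM2r// kn_le3.
  rewrite k_div_m//= ler_pdivrMr ?exprn_gt0// mul1r.
  by apply: (@le_trans _ _ k%:R); rewrite ?ler_eXnr//; lra.
have h0 : 0 <= (k * n)%:R * (2 * k%:R / m%:R) :> R.
  by rewrite mulr_ge0// divr_ge0// mulr_ge0.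
apply: (@le_trans _ _ ((2 * s) ^+ 2)).
  by apply: lerXn2r; rewrite ?nnegrE; have := s_ge0; lra.
rewrite exprMn s2E; have -> : 2 ^+ 2 = 4 :> R by ring.
by rewrite ler_wpM2l// expr2 mulrA ler_wpM2r// powR_ge0.
Qed.

(** A sparse vector costs [10 * L] in the exponent per nonzero entry, so [gam / 60] caps the total
    at [gam * L * k / 6], half of the gain [gam * L * k / 3] from the small ball. *)
Let r := Num.truncn (gam / 60 * k%:R).

Let r_le : r%:R <= gam / 60 * k%:R.
Proof. by rewrite truncn_le mulr_ge0//; case/andP: gam01; lra. Qed.

Lemma mesh_le : 2 * (u^-1 + 2 * (r%:R * k%:R / m%:R)) <= 4 / u.
Proof.
have h9 := k9R; have h48 := L48; have h4 := u4.
have u0 : 0 < u by lra.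
suff : 2 * (r%:R * k%:R / m%:R) <= u^-1 by lra.
apply: (@le_trans _ _ (k%:R^-1)); last first.
  rewrite lef_pV2 ?posrE//; apply: le_trans u2_le.
  by rewrite expr2 ler_peMr//; lra.
apply: (@le_trans _ _ (2 * (k%:R ^+ 2 / m%:R))).
  rewrite ler_wpM2l// ler_wpM2r ?invr_ge0// expr2 ler_wpM2r//.
  apply: (le_trans r_le); rewrite -[leRHS]mul1r ler_wpM2r//.
  by case/andP: gam01; lra.
rewrite k_div_m//= -[4%N]/(3.+1) exprSr invfM mulrA -[leRHS]mul1r.
rewrite ler_wpM2r ?invr_ge0// ler_pdivrMr ?exprn_gt0// mul1r.
by apply: (@le_trans _ _ k%:R); rewrite ?ler_eXnr//; lra.
Qed.

(** The half of the gain left after paying for the sparse vectors is at least [4 * k] by [gL]; this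
    absorbs the choice of column, the [2^k] row sets and the constant 4 in [mesh_le]. *)
Lemma sparse_bound :
  n%:R * (n * (2 * k * m).+1)%:R ^+ r * 2 ^+ k *
      (2 * (u^-1 + 2 * (r%:R * k%:R / m%:R))) ^+ k./2 <= expR (- k%:R).
Proof.
have h9 := k9R; have h48 := L48; have h4 := u4.
have u0 : 0 < u by lra.
have L0 : 0 <= L by lra.
case/andP: gam01 => g0 g1.
have two : 2 <= expR 1 :> R by have := expR_ge1Dx (1 : R); lra.
have hN : (n * (2 * k * m).+1)%:R <= expR (10 * L).
  rewrite natrM (_ : 10 * L = 2 * L + 8 * L); last by ring.
  rewrite expRD; apply: ler_pM => //.
    by rewrite expRM_natl -knat_exp n_le2.
  rewrite expRM_natl -knat_exp -natrX ler_nat /m -mulnA -expnS.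
  rewrite [(k ^ 8)%N]expnS; apply: leq_trans (leq_mul k9 (leqnn _)).
  have : (0 < k ^ 7)%N by rewrite expn_gt0 (leq_trans _ k9).
  by move: (k ^ 7)%N => a; clear; lia.
have b0 : 0 <= 2 * (u^-1 + 2 * (r%:R * k%:R / m%:R)).
  by rewrite mulr_ge0// addr_ge0 ?invr_ge0 ?(ltW u0).
have f1 : n%:R <= expR (2 * L) by rewrite expRM_natl -knat_exp n_le2.
have f2 : (n * (2 * k * m).+1)%:R ^+ r <= expR (gam * L * k%:R / 6).
  apply: (@le_trans _ _ (expR (10 * L) ^+ r)).
    by rewrite lerXn2r// nnegrE ?expR_ge0.
  rewrite -expRM_natr ler_expR.
  apply: (@le_trans _ _ (10 * L * (gam / 60 * k%:R))).
    by rewrite ler_wpM2l ?mulr_ge0// r_le.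
  by rewrite le_eqVlt; apply/orP; left; apply/eqP; field.
have f3 : 2 ^+ k <= expR k%:R :> R.
  by rewrite -[k%:R]mul1r expRM_natr lerXn2r// nnegrE ?expR_ge0.
have f4 : (2 * (u^-1 + 2 * (r%:R * k%:R / m%:R))) ^+ k./2 <=
    expR ((2 - gam * L) * (k%:R / 3)).
  apply: (@le_trans _ _ (expR (2 - gam * L) ^+ k./2)).
    rewrite lerXn2r ?nnegrE ?expR_ge0//.
    apply: (le_trans mesh_le); rewrite expRD expRN -u_exp.
    rewrite ler_wpM2r ?invr_ge0 ?(ltW u0)//.
    have -> : 2 = 1 + 1 :> R by ring.
    rewrite expRD; have := ler_pM _ _ two two.
    by rewrite ler0n => /(_ isT isT); lra.
  (* As [2 - gam * L] is negative, a lower bound on [k./2] is needed; [k / 3] allows for the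
     rounding when [k] is odd. *)
  rewrite -expRM_natr ler_expR ler_wnM2l//.
    by move: gL; rewrite ler_pdivrMr// mulrC; lra.
  rewrite ler_pdivrMr// -natrM ler_nat.
  have := k9; have := odd_double_half k; rewrite -muln2.
  by move: (k./2) => h; case: (odd k) => /=; clear; lia.
apply: (@le_trans _ _ (expR (2 * L) * expR (gam * L * k%:R / 6) * expR k%:R *
    expR ((2 - gam * L) * (k%:R / 3)))).
  have p1 : 0 <= (n * (2 * k * m).+1)%:R ^+ r :> R by exact: exprn_ge0.
  have p2 : 0 <= 2 ^+ k :> R by exact: exprn_ge0.
  apply: ler_pM f4; rewrite ?mulr_ge0 ?exprn_ge0//.
  by apply: ler_pM f3; rewrite ?mulr_ge0//; exact: ler_pM f2.
rewrite -!expRD ler_expR.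
have : 24 * k%:R <= gam * L * k%:R.
  by rewrite ler_wpM2r//; move: gL; rewrite ler_pdivrMr// mulrC.
by have := L2_le; lra.
Qed.

End bounds.

(** This collects the three failure probabilities: [3 <= expR 2], and [2 - x <= - x / 2] for
    [x >= 4]. *)
Lemma three_expR_le (R : realType) (x : R) : 4 <= x ->
  expR (- x) + (expR (- x) + expR (- x)) <= 2 `^ (- 2^-1 * x).
Proof.
move=> x4; have ln2 : ln 2 <= 1 :> R.
  by have := @le_ln1Dx R 1; rewrite -[1 + 1]/(2); apply; lra.
have l0 : 0 <= ln 2 :> R by rewrite ln_ge0// ler1n.
apply: (@le_trans _ _ (expR 2 * expR (- x))).
  have : 3 * expR (- x) <= expR 2 * expR (- x).
    by rewrite ler_wpM2r ?expR_ge0//; have := expR_ge1Dx (2 : R); lra.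
  by lra.
rewrite -expRD /powR gt_eqF// ler_expR.
have : 2^-1 * x * ln 2 <= 2^-1 * x * 1 by rewrite ler_wpM2l//; lra.
by lra.
Qed.

Lemma half_powR_ge (R : realType) (a : R) :
  0 <= a <= 1 -> 2^-1 <= 2^-1 `^ a :> R.
Proof.
move=> /andP[a0 a1]; rewrite /powR gt_eqF// -[leLHS]lnK ?posrE// ler_expR.
have : ln 2^-1 <= 0 :> R by rewrite ln_le0//; lra.
by move=> l0; rewrite -[leLHS]mul1r; apply: ler_wnM2r.
Qed.

(** Put [q = u^-1], so that [q^8 = K^(-2 alpha)]. The powers of [K] without [alpha] cancel in
    [theta^(2-p) * t^p], leaving [D * q^8], and [S^2] gives back at most [4 * K * q^-2]. Both terms
    are thus at most a constant times [K * q^3]; one factor [q] absorbs the constants and [q^2] is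
    the target. *)
Lemma sparse_split_bound (R : realType) (p alpha S eta t theta u K : R) :
  1 < p < 2 -> 0 < alpha -> 0 < eta -> 1 <= K ->
  t = K `^ (p^-1 - 2^-1 - alpha) ->
  theta = t * (eta * K) `^ (- p^-1) ->
  u = K `^ (alpha / 4) ->
  4 * (1 + 4 * eta `^ (1 - 2 / p)) <= u ->
  S ^+ 2 <= 4 * (K * u ^+ 2) ->
  2 * (t ^+ 2 + S ^+ 2 * (theta `^ (2 - p) * t `^ p)) <= u^-1 ^+ 2 * (K / 2).
Proof.
move=> /andP[p1 p2] al0 eta0 K1 tE thE uE uD hS.
have K0 : 0 < K by lra.
have p0 : 0 < p by lra.
have t0 : 0 < t by rewrite tE powR_gt0.
have u0 : 0 < u by rewrite uE powR_gt0.
set D := eta `^ _ in uD.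
have D0 : 0 <= D by exact: powR_ge0.
set q := u^-1; have q0 : 0 < q by rewrite invr_gt0.
have qu : q * u = 1 by rewrite mulVf// gt_eqF.
have qD : 4 * (1 + 4 * D) * q <= 1.
  by rewrite -[leRHS]qu [q * u]mulrC; apply: ler_wpM2r => //; exact: ltW.
have q1 : q <= 1 by apply: le_trans qD; rewrite ler_peMl ?(ltW q0)//; lra.
have q8 : q ^+ 8 = K `^ (- (2 * alpha)).
  rewrite /q uE -powRN -powR_mulrn ?powR_ge0// -powRrM; congr (_ `^ _).
  by field.
have t2E : t ^+ 2 = K `^ (2 * (p^-1 - 2^-1 - alpha)).
  by rewrite tE -powR_mulrn ?powR_ge0// -powRrM mulrC.
have KD r s : K `^ (r + s) = K `^ r * K `^ s.
  by rewrite powRD// (gt_eqF K0) implybT.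
have ip : p^-1 < 1 by rewrite invf_lt1.
have t2 : t ^+ 2 <= K * q ^+ 8.
  rewrite t2E q8 -[X in _ <= X * _](powRr1 (ltW K0)) -KD ler_powR//.
  by lra.
have x0 : 0 < eta * K by rewrite mulr_gt0.
have thE2 : theta `^ (2 - p) * t `^ p = D * q ^+ 8.
  rewrite thE powRM ?powR_ge0 ?(ltW t0)// mulrAC -powRD ?(gt_eqF t0) ?implybT//.
  rewrite subrK powR_mulrn ?(ltW t0)// -powRrM.
  have -> : - p^-1 * (2 - p) = 1 - 2 / p by field; rewrite gt_eqF.
  rewrite powRM ?(ltW eta0) ?(ltW K0)// t2E mulrCA -KD q8.
  by congr (_ * (_ `^ _)); field; rewrite gt_eqF.
have h1 : S ^+ 2 * (theta `^ (2 - p) * t `^ p) <= 4 * K * D * q ^+ 6.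
  rewrite thE2; apply: (@le_trans _ _ (4 * (K * u ^+ 2) * (D * q ^+ 8))).
    by rewrite ler_wpM2r// mulr_ge0// exprn_ge0// ltW.
  rewrite (_ : 4 * (K * u ^+ 2) * (D * q ^+ 8) =
    4 * K * D * q ^+ 6 * (q * u) ^+ 2); last by ring.
  by rewrite qu expr1n mulr1.
have q3 n : q ^+ n.+3 <= q ^+ 3 by rewrite ler_wiXn2l// ltW.
have h2 : K * q ^+ 8 <= K * q ^+ 3.
  by rewrite ler_wpM2l ?(ltW K0)//; exact: (q3 5%N).
have h3 : 4 * K * D * q ^+ 6 <= 4 * K * D * q ^+ 3.
  by rewrite ler_wpM2l ?mulr_ge0 ?(ltW K0)//; exact: (q3 3%N).
have h4 : K * q ^+ 2 * (4 * (1 + 4 * D) * q) <= K * q ^+ 2 * 1.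
  by rewrite ler_wpM2l// mulr_ge0 ?exprn_ge0// ltW.
have -> : q ^+ 2 * (K / 2) = K * q ^+ 2 * 1 / 2 by field.
apply: (@le_trans _ _ (K * q ^+ 2 * (4 * (1 + 4 * D) * q) / 2)); last first.
  by rewrite ler_wpM2r// invr_ge0.
have -> : K * q ^+ 2 * (4 * (1 + 4 * D) * q) / 2 =
  2 * (K * q ^+ 3 + 4 * K * D * q ^+ 3) by field.
rewrite ler_wpM2l// lerD//.
  exact: le_trans t2 h2.
exact: le_trans h1 h3.
Qed.

(** * Assembly of the probability bound *)

Lemma probability_ge_of_outer (R : realType) d (T : measurableType d)
    (P : probability T R) (E : set T) (e : R) :
  measurable E -> outer_prob_le P (~` E) e -> ((1 - e)%:E <= P E)%E.
Proof.
move=> mE [W [mW EW We]].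
have PW : (P (~` E) <= e%:E)%E.
  apply: (@le_trans _ _ (P W)).
    by apply: le_measure; rewrite ?inE//; exact: measurableC.
  by rewrite -[P W]fineK ?fin_num_measure// lee_fin.
move: PW; rewrite probability_setC// -[P E]fineK ?fin_num_measure//.
by rewrite -EFinB !lee_fin; lra.
Qed.

Lemma measurable_css_event (R : realType) (p a : R) (k n : nat) d
    (T : measurableType d) (P : probability T R)
    (G : 'I_k * 'I_n -> {RV P >-> R}) (cond : {set 'I_n} -> Prop) :
  0 < p ->
  measurable [set w : T | forall S, cond S ->
    a * rank_error p k (gauss_over_id G w) <= css_error p (gauss_over_id G w) S].
Proof.
move=> p0.
rewrite (_ : mkset _ = \bigcap_(S in [set S | cond S]) [set w |
  a * rank_error p k (gauss_over_id G w) <= css_error p (gauss_over_id G w) S]).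
  apply: fin_bigcap_measurable => [|S _]; first exact: finite_finset.
  have mM := @measurable_gauss_over_id _ _ _ P k n G.
  have /(_ measurableT [set true]) := measurable_fun_ler
    (measurable_funM (@measurable_cst _ _ _ _ setT a)
      (measurable_rank_error k p0 mM))
    (measurable_css_error S p0 mM).
  by rewrite setTI; apply.
by apply/seteqP; split => w /= h S; exact: h.
Qed.

Theorem theoremB9 (R : realType) (p c alpha C0 : R)
    (hp : 1 < p < 2) (hc : 1 <= c)
    (halpha : 0 < alpha < p^-1 - 2^-1) (hC0 : 0 < C0) :
  exists (C c' : R) (k0 : nat), 0 < C /\ 0 < c' /\
    forall (k n : nat),
      (k0 <= k)%N ->
      n%:R <= C0 * (k%:R * (ln k%:R) `^ c) ->
      forall (d : measure_display) (T : measurableType d) (P : probability T R)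
        (G : 'I_k * 'I_n -> {RV P >-> R}),
        iid_standard_normal G ->
        let E := [set w : T | forall S : {set 'I_n},
          #|S|%:R <= n%:R / 2 :> R ->
          C * k%:R `^ (p^-1 - 2^-1 - alpha) * rank_error p k (gauss_over_id G w)
            <= css_error p (gauss_over_id G w) S] in
        measurable E /\ ((1 - 2 `^ (- c' * k%:R))%:E <= P E)%E.
Proof.
have /andP[p1 p2] := hp; have /andP[al0 al1] := halpha.
have p0 : 0 < p by lra.
have ip0 : 0 < p^-1 by rewrite invr_gt0.
have ip1 : p^-1 < 1 by rewrite invf_lt1.
pose gam := alpha / 4; have g0 : 0 < gam by rewrite divr_gt0.
have g01 : 0 < gam <= 2^-1 by rewrite g0/= /gam; lra.
pose eta := gam / 60; have eta0 : 0 < eta by rewrite divr_gt0.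
have [k0 hk0] := eventually_powR_large
  (4 * (1 + 4 * eta `^ (1 - 2 / p))) hc g0 hC0.
(* The first constant bounds [(1/2)^(1/p)] from below, the loss from having only [n/2] columns
   outside [S]; the second is the rate in [three_expR_le]. *)
exists 2^-1, 2^-1, k0; split; [by []|split => //].
move=> k n /hk0 [k9 uD uC uL gL] hn d T P G iidG E.
have mE : measurable E by exact: measurable_css_event.
split => //; apply: probability_ge_of_outer => //.
have kR : 9 <= k%:R :> R by rewrite ler_nat.
have k_gt0 : 0 < k%:R :> R by lra.
(* If [n <= k], the rank error vanishes and the event is certain. *)
have [nk|kn] := leqP n k.
  exists set0; split => //; last by rewrite measure0 powR_ge0.
  move=> w; apply => S _; apply: le_trans (css_error_ge0 _ _ _).
  by rewrite mulr_ge0_le0 ?rank_error_le0.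
set u := k%:R `^ gam in uD uC uL.
have n_le : n%:R <= k%:R * u.
  by apply: (le_trans hn); rewrite mulrCA ler_wpM2l// ltW.
have m0 : (0 < k ^ 6)%N by rewrite expn_gt0 (leq_trans _ k9).
have u0 : 0 < u by rewrite powR_gt0.
pose r := Num.truncn (eta * k%:R).
have b1 : 2 * (u^-1 + 2 * (r%:R * k%:R / (k ^ 6)%:R)) <= 1.
  apply: (le_trans (mesh_le g01 k9 uL gL)).
  have L0 : 0 <= ln k%:R :> R by rewrite ln_ge0//; lra.
  by rewrite ler_pdivrMr// mul1r -/u; move: uL L0; lra.
pose s := Num.sqrt (n%:R * u).
have s0 : 0 <= s by exact: sqrtr_ge0.
have A0 := outer_prob_le_tail iidG (ler0n R k).
have A1 := outer_prob_le_opnorm iidG k m0 s0.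
have ui0 : 0 < u^-1 by rewrite invr_gt0.
have A2 := outer_prob_le_sparse iidG m0 ui0 b1.
(* Three failures are possible: an entry of modulus at least [k], a large operator norm, or a column
   close to a sparse combination of the others. *)
apply: outer_prob_leW (outer_prob_leU A0 (outer_prob_leU A1 A2)); last first.
  apply: le_trans (three_expR_le _); last by lra.
  apply: lerD; [|apply: lerD].
  - by rewrite card_prod !card_ord; exact: (tail_bound g01).
  - exact: (opnorm_bound g01).
  - exact: (sparse_bound g01).
move=> w; apply: contra_notP => /not_orP[hA0 /not_orP[hA1 hA2]] S hS.
have GK ij : `|G ij w| <= k%:R.
  by apply/ltW; rewrite ltNge; apply/negP => h; apply: hA0; exists ij.
pose A := \matrix_(i, j) G (i, j) w : 'M[R]_(k, n).
set S' := s + (k * n)%:R * (2 * k%:R / (k ^ 6)%:R) in A1 hA1.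
pose t : R := k%:R `^ (p^-1 - 2^-1 - alpha).
(* Chosen so that [theta^p = t^p / (eta * k)]; with [r.+1 > eta * k] this yields the count of large
   entries. *)
pose theta := t * (eta * k%:R) `^ (- p^-1).
have t0 : 0 < t by rewrite powR_gt0.
have k1 : 1 <= k%:R :> R by lra.
have tk : t <= k%:R.
  by rewrite -[leRHS](powRr1 (ltW k_gt0)); apply: ler_powR => //; lra.
have x0 : 0 < eta * k%:R by rewrite mulr_gt0.
have cost := @column_cost_ge R p t theta S' (u^-1 ^+ 2 * (k%:R / 2)) k n r k A hp.
have {}cost (j : 'I_n) (y : 'I_n -> R) : y j = 0 ->
    t `^ p <= \sum_i `|\sum_l A i l * y l - A i j| `^ p + \sum_l `|y l| `^ p.
  apply: cost.
  - by rewrite t0.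
  - by rewrite mulr_gt0// powR_gt0.
  - rewrite /theta powRM ?powR_ge0 ?(ltW t0)// -powRrM mulNr mulVf ?gt_eqF//.
    rewrite powR_inv1 ?(ltW x0)// mulrCA ler_peMr ?powR_ge0//.
    by rewrite ler_pdivlMr// mul1r ltW// truncnS_gt.
  - apply: (@sparse_split_bound _ _ alpha _ eta) => //.
    exact: (opnorm_const g01).
  - move=> x; rewrite leNgt; apply/negP => h; apply: hA1; split => //.
    exists x; apply: (lt_le_trans h); rewrite le_eqVlt; apply/orP; left.
    by apply/eqP; apply: eq_bigr => i _; under eq_bigr do rewrite mxE.
  - move=> {}j {}y yj ys yK; rewrite ltNge; apply/negP => h; apply: hA2.
    split => //; exists j, y; split => //; apply: le_trans h.
    rewrite le_eqVlt; apply/orP; left; apply/eqP; apply: eq_bigr => i _.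
    by rewrite mxE; under [in RHS]eq_bigr do rewrite mxE.
have := css_error_col_mx1_ge p0 (powR_ge0 t p) cost hS.
apply: le_trans.
apply: (@le_trans _ _ (2^-1 * t * n%:R `^ p^-1)).
  rewrite ler_wpM2l ?mulr_ge0 ?(ltW t0)//.
  exact: rank_error_col_mx1.
rewrite powRM ?powR_ge0 ?divr_ge0// -powRrM divff ?gt_eqF// powRr1 ?(ltW t0)//.
rewrite powRM ?invr_ge0// mulrAC [X in _ <= X * _]mulrC.
rewrite ler_wpM2r ?(ltW t0)// ler_wpM2r ?powR_ge0//.
by apply: half_powR_ge; rewrite ltW//= ltW.
Qed.
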